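(* Let $G$ be a finite group, let $V$ be a rational FPF representation of $G$ of dimension $n=\dim_{\mathbb{Q}}V$, let $L\subset V$ be a $G$-invariant full-rank lattice, and consider the induced $G$-action on $V_{\mathbb{C}}/L$. Then the orbifold Euler characteristic of the quotient $V_{\mathbb{C}}/(G\ltimes L)=(V_{\mathbb{C}}/L)/G$ is \[\chi_{\mathrm{orb}}(V_{\mathbb{C}}/(G\ltimes L))=\frac{1}{|G|}\sum_{d\mid |G|} \varphi(d)\cdot c_d(G)\cdot\Phi_{d}(1)^{\frac{n}{\varphi(d)}},\] where $c_d(G)$ is the number of cyclic subgroups of $G$ of order $d$.
   Context: A rational FPF (fixed-point-free) representation of a finite group $G$ is a nonzero finite-dimensional $\mathbb{Q}$-vector space $V$ with a linear $G$-action such that $\det(g-\mathrm{id}\mid V)\neq 0$ for every non-identity $g\in G$. A $G$-invariant full-rank lattice $L\subset V$ is a $G$-stable free $\mathbb{Z}$-submodule spanned by a $\mathbb{Q}$-basis of $V$. Put $V_{\mathbb{C}}=V\otimes_{\mathbb{Q}}\mathbb{C}$; the action of $G$ extends $\mathbb{C}$-linearly to $V_{\mathbb{C}}$ and induces an action on the torus $V_{\mathbb{C}}/L\cong(\mathbb{C}/\mathbb{Z})^n$ by $g\cdot[x]=[gx]$. For a finite group $G$ acting on a space $X$, the orbifold Euler characteristic is $\chi_{\mathrm{orb}}(X/G):=\frac{1}{|G|}\sum_{g\in G}\chi(\operatorname{Fix}(g))$, where $\operatorname{Fix}(g)=\{x\in X: gx=x\}$ and $\chi$ is the ordinary Euler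 characteristic. Here $\varphi$ is Euler's totient function, and $\Phi_d$ is the $d$-th cyclotomic polynomial (so $\Phi_1(1)=0$). *)

(* Defs.v *)
From HB Require Import structures.
From mathcomp Require Import all_boot all_order all_algebra all_fingroup.
From mathcomp Require Import cyclic mxrepresentation cyclotomic complex freeg.
From mathcomp Require Import all_classical all_reals all_analysis.

Set Implicit Arguments.
Unset Strict Implicit.
Unset Printing Implicit Defensive.

Import Order.TTheory GRing.Theory Num.Theory numFieldNormedType.Exports.

Local Open Scope classical_set_scope.
Local Open Scope ring_scope.

(** * Singular homology with rational coefficients *)

Definition std_simplex (R : realType) (k : nat) : set 'rV[R]_k.+1 :=
  [set x | (forall i, 0 <= x 0 i) /\ \sum_i x 0 i = 1].
Arguments std_simplex R k : clear implicits.

Section Face.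
Variables (R : realType) (k : nat) (i : 'I_k.+2).

(* Inserts a zero in position [i]. *)
Definition face_row (x : 'rV[R]_k.+1) : 'rV[R]_k.+2 :=
  \row_(j < k.+2) (if unlift i j is Some j' then x 0 j' else 0).

Lemma face_row_lift (x : 'rV[R]_k.+1) (j : 'I_k.+1) :
  face_row x 0 (fintype.lift i j) = x 0 j.
Proof. by rewrite mxE liftK. Qed.

Lemma face_row_simplex x :
  std_simplex R k x -> std_simplex R k.+1 (face_row x).
Proof.
move=> [x_ge0 x1]; split=> [j|]; first by rewrite mxE; case: unlift.
rewrite (bigD1_ord i) //= mxE unlift_none add0r -[RHS]x1.
by apply: eq_bigr => j _; rewrite face_row_lift.
Qed.

Definition face (x : std_simplex R k) : std_simplex R k.+1 :=
  exist _ (face_row (set_val x)) (mem_set (face_row_simplex (set_valP x))).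

Lemma face_row_continuous : continuous face_row.
Proof.
move=> x A /nbhs_ballP[e /= e0 eA]; apply/nbhs_ballP; exists e => //= y [_ xy].
apply: eA; split=> // j l; rewrite !mxE.
by case: unliftP => [l' _|_]; [exact: xy | exact: ballxx].
Qed.

Lemma face_continuous : continuous face.
Proof.
apply: continuous_comp_initial => x; rewrite [_ \o _]/(face_row \o set_val).
apply: continuous_comp; first exact: initial_continuous.
exact: face_row_continuous.
Qed.

HB.instance Definition _ := isContinuous.Build _ _ face face_continuous.

End Face.

Section Homology.
Variables (R : realType) (X : topologicalType).

Definition singular_simplex (k : nat) := continuousType (std_simplex R k) X.

Definition chain (k : nat) := {freeg (singular_simplex k) / rat}.

Definition simplex_face k (s : singular_simplex k.+1) (i : 'I_k.+2) :
  singular_simplex k := s \o face i.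

Definition boundary (k : nat) : chain k.+1 -> chain k :=
  fglift (fun s : singular_simplex k.+1 =>
    \sum_(i < k.+2) (-1) ^+ i *: (<< simplex_face s i >> : chain k)).

Definition is_cycle (k : nat) : chain k -> Prop :=
  match k with
  | 0 => fun=> True
  | _.+1 => fun c => boundary c = 0
  end.

Definition is_boundary (k : nat) (c : chain k) : Prop :=
  exists b : chain k.+1, boundary b = c.

(* [m] is the dimension of the rational homology in degree [k]: some [m] cycles
   represent a basis of the cycles modulo the boundaries. *)
Definition is_betti (k m : nat) : Prop :=
  exists2 z : 'I_m -> chain k, (forall i, is_cycle (z i)) &
    forall c, is_cycle c ->
      exists! a : 'rV[rat]_m, is_boundary (c - \sum_i a 0 i *: z i).

Definition betti (k : nat) : nat := xget 0%N [set m | is_betti k m].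

Definition finite_homology : Prop :=
  (forall k, exists m, is_betti k m) /\
  (exists N, forall k, (N <= k)%N -> is_betti k 0).

Definition euler_char : int :=
  \sum_(k \in [set: nat]) (-1) ^+ k * (betti k)%:Z.

End Homology.

(** * The orbifold Euler characteristic *)

Definition fixed_points (X : Type) (f : X -> X) : set X := [set x | f x = x].

Definition orb_euler_char (R : realType) (gT : finGroupType) (G : {group gT})
    (X : topologicalType) (act : gT -> X -> X) : R :=
  #|G|%:R^-1 * \sum_(g in G) (euler_char R (fixed_points (act g)))%:~R.

(** * Representations, lattices and tori *)

(* The group acts on the left of column vectors, [g . v = rG g *m v]. *)
Definition rational_fpf (gT : finGroupType) (G : {group gT}) (n : nat)
    (rG : mx_representation rat G n) : Prop :=
  (0 < n)%N /\
  forall g, g \in G -> g != 1%g -> \det (rG g - 1%:M) != 0.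

Definition full_rank_lattice (n : nat) (L : zmodClosed 'cV[rat]_n) : Prop :=
  exists2 B : 'M[rat]_n, B \in unitmx &
    forall v, v \in L <-> exists z : 'cV[int]_n, v = B *m map_mx intr z.

Definition invariant_lattice (gT : finGroupType) (G : {group gT}) (n : nat)
    (rG : mx_representation rat G n) (L : zmodClosed 'cV[rat]_n) : Prop :=
  forall g v, g \in G -> v \in L -> rG g *m v \in L.

(* The type annotation gives [R[i]] the topology that every [numClosedFieldType]
   carries. *)
Definition CC (R : realType) : numClosedFieldType := R[i]%C.

Section Torus.
Local Open Scope quotient_scope.
Variables (R : realType) (n : nat) (L : zmodClosed 'cV[rat]_n).

Definition complex_lattice : {pred 'cV[CC R]_n} :=
  [pred x | `[< exists2 v, v \in L & x = map_mx ratr v >]].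

Lemma complex_lattice_zmod_closed : zmod_closed complex_lattice.
Proof.
split=> [|_ _ /asboolP[u uL ->] /asboolP[v vL ->]]; apply/asboolP.
  by exists 0; rewrite ?rpred0 ?map_mx0.
by exists (u - v); rewrite ?rpredB // map_mxB.
Qed.

HB.instance Definition _ :=
  GRing.isZmodClosed.Build _ complex_lattice complex_lattice_zmod_closed.

Definition torus : Type := quotient_topology (Quotient.quot complex_lattice).
HB.instance Definition _ := Quotient.on torus.
HB.instance Definition _ := Topological.on torus.

Lemma torus_eqP (x y : 'cV[CC R]_n) :
  reflect (\pi_torus x = \pi_torus y :> torus) (x - y \in complex_lattice).
Proof. by rewrite Quotient.idealrBE; apply: (iffP eqP) => xy; exact: xy. Qed.

End Torus.

Section TorusAction.
Variables (R : realType) (gT : finGroupType) (G : {group gT}) (n : nat).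
Variables (rG : mx_representation rat G n) (L : zmodClosed 'cV[rat]_n).
Local Open Scope quotient_scope.

Definition complex_act (g : gT) (x : 'cV[CC R]_n) : 'cV[CC R]_n :=
  map_mx ratr (rG g) *m x.

Definition torus_act (g : gT) (x : torus R L) : torus R L :=
  \pi_(torus R L) (complex_act g (generic_quotient.repr x)).

Lemma torus_act_pi (GL : invariant_lattice rG L) (g : gT) (x : 'cV[CC R]_n) :
  g \in G ->
  torus_act g (\pi_(torus R L) x) = \pi_(torus R L) (complex_act g x).
Proof.
move=> gG; apply/torus_eqP.
have /torus_eqP/asboolP[v vL xv] :
    \pi_(torus R L) (generic_quotient.repr (\pi_(torus R L) x)) =
    \pi_(torus R L) x by rewrite reprK.
apply/asboolP; exists (rG g *m v); first exact: GL.
by rewrite map_mxM -xv -mulmxBr.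
Qed.

End TorusAction.
Arguments torus_act R {gT G n} rG L g x.

(** * Cyclic subgroups *)

Definition cyclic_subgroups (gT : finGroupType) (G : {group gT}) (d : nat) :
    {set {group gT}} :=
  [set H : {group gT} | [&& H \subset G, cyclic H & #|H| == d]].

(* Main.v *)
(** A singular simplex of the torus $(\mathbb C/\mathbb Z)^n$ lifts to the
    contractible space $\mathbb R^n\times\mathbb R^n$, uniquely up to a lattice
    translation. Hence the chains of the torus are the coinvariants of the chains
    of a contractible space under $n$ commuting translations. Killing one
    translation $\tau$ at a time, $\tau-1$ is injective on the remaining
    coinvariants and homotopic to zero, so the $k$-th Betti number becomes
    $b_k+b_{k-1}$; this gives $b_k=\binom nk$ and Euler characteristic $0$.

    For $g\ne1$ the lift $x$ of a simplex fixed by $g$ makes $(g-1)x$ lattice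
    valued, hence constant, so the fixed locus behaves like a discrete set. It has
    $|\det(g-1)|$ points by the Smith normal form. All eigenvalues of $g$ are
    primitive $d$-th roots of unity, where $d$ is the order of $g$, so the
    characteristic polynomial of $g$ is $\Phi_d^{n/\varphi(d)}$. Grouping the
    elements by the cyclic group they generate gives the formula. *)

(* The count [b_k + b_(k-1)] comes from the short exact sequence of a complex, itself, and the
   cokernel of $\tau-1$: a null-homotopic map is zero on homology, so the long exact sequence breaks
   into short ones. Here the bases are built by hand, and a quotient is a predicate on chains, so no
   module of coinvariants is ever formed.

   Two obstacles shape the argument. The homotopy must descend to the later coinvariants, hence
   commute with every translation, which rules out coning to a fixed point. And injectivity of
   $\tau-1$ is clear on chains, where supports are finite and orbits infinite, but not on
   coinvariants; a fundamental domain in the directions already killed brings it back to chains.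

   For $g\ne1$ the discreteness of the fixed locus is never proved: singular homology only sees that
   all simplices are constant. The identity fits the formula because $\Phi_1(1)=0$ and $n>0$. *)
Require Import Defs.
From HB Require Import structures.
From mathcomp Require Import all_boot all_order all_algebra all_fingroup.
From mathcomp Require Import cyclic mxrepresentation cyclotomic complex freeg.
From mathcomp Require Import all_classical all_reals all_analysis.
From mathcomp Require Import algC.
From mathcomp Require Import zify ring lra.

Import Order.TTheory GRing.Theory Num.Theory numFieldNormedType.Exports.
Local Open Scope classical_set_scope.
Local Open Scope ring_scope.

Set Implicit Arguments.
Unset Strict Implicit.
Unset Printing Implicit Defensive.

(** * Homology of a complex modulo a subcomplex *)

Section FreeModule.
Variables (R : nzRingType) (K : choiceType).

Section Lift.
Variables (M : lmodType R) (f : K -> M).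

(** Additivity does not give homogeneity; since [a *: u] is by definition a sum of generators with
    scaled coefficients, both sides can be computed on such sums. *)
Lemma fglift_linear : linear (fglift f : {freeg K / R} -> M).
Proof.
move=> a u v; rewrite -[a *: u]opprK -[_ + v]addrC lift_is_additive.
have N w : fglift f (- w) = - fglift f w.
  by rewrite -[- w]sub0r lift_is_additive -[X in _ X - _](subrr w)
    lift_is_additive subrr sub0r.
rewrite N opprK addrC; congr (_ + _).
have S (s : seq K) (g : K -> R) :
    fglift f (\sum_(x <- s) << g x *g x >>) = \sum_(x <- s) g x *: f x.
  elim: s => [|x s IHs]; first by rewrite !big_nil -[0 in LHS](subrr 0)
    lift_is_additive subrr.
  by rewrite !big_cons -[X in _ + X]opprK lift_is_additive N opprK IHs liftU.
rewrite [a *: u]/(fgscale a u) /fgscale S -[u in RHS]freeg_sumE S scaler_sumr.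
by apply: eq_bigr => x _; rewrite scalerA.
Qed.

HB.instance Definition _ :=
  GRing.isLinear.Build R {freeg K / R} M *:%R (fglift f) fglift_linear.

Lemma fgliftU1 x : fglift f << x >> = f x.
Proof. by rewrite liftU scale1r. Qed.

End Lift.

Lemma freeg_ind_sub (P : {freeg K / R} -> Prop) :
  P 0 -> (forall a u v, P u -> P v -> P (a *: u + v)) ->
  (forall x, P << x >>) -> forall u, P u.
Proof.
move=> P0 PL P1 u; rewrite -(freeg_sumE u).
elim: (dom u) => [|x s IHs]; rewrite ?big_nil // big_cons.
suff -> : << coeff x u *g x >> = coeff x u *: (<< x >> : {freeg K / R}).
  exact: PL.
by apply/eqP/freeg_eqP => y; rewrite coeffZ !coeffU mul1r.
Qed.

Lemma freeg_lin_ext (M : lmodType R) (f g : {linear {freeg K / R} -> M}) :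
  (forall x, f << x >> = g << x >>) -> f =1 g.
Proof.
move=> fg; apply: freeg_ind_sub => // [|a u v fu fv].
  by rewrite !linear0.
by rewrite !linearP /= fu fv.
Qed.

End FreeModule.

Section RelativeHomology.
Variables (F : fieldType) (K : nat -> lmodType F).
Variable d : forall k, {linear K k.+1 -> K k}.
Hypothesis dd : forall k c, d k (d k.+1 c) = 0.

Definition subspaces (I : forall k, K k -> Prop) : Prop :=
  forall k, I k 0 /\ forall a u v, I k u -> I k v -> I k (a *: u + v).

Section Subspaces.
Variables (I : forall k, K k -> Prop) (subI : subspaces I).

Lemma subspaces0 k : I (0 : K k). Proof. by case: (subI k). Qed.

Lemma subspacesD k (u v : K k) : I u -> I v -> I (u + v).
Proof. by case: (subI k) => _ L Iu Iv; rewrite -[u]scale1r; exact: L. Qed.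

Lemma subspacesZ k a (u : K k) : I u -> I (a *: u).
Proof.
by case: (subI k) => I0 L Iu; rewrite -[_ *: _]addr0; exact: L.
Qed.

Lemma subspacesN k (u : K k) : I u -> I (- u).
Proof. by move=> Iu; rewrite -scaleN1r; exact: subspacesZ. Qed.

Lemma subspacesB k (u v : K k) : I u -> I v -> I (u - v).
Proof. by move=> Iu Iv; apply: subspacesD => //; exact: subspacesN. Qed.

Lemma subspaces_sum k (J : Type) (r : seq J) (u : J -> K k) :
  (forall j, I (u j)) -> I (\sum_(j <- r) u j).
Proof.
by move=> Iu; elim/big_ind: _ => // *; [exact: subspaces0|exact: subspacesD].
Qed.

End Subspaces.

Section Betti.
Variable I : forall k, K k -> Prop.

Definition rel_cycle k : K k -> Prop :=
  if k is k'.+1 then fun c => I (d k' c) else fun=> True.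

(* Betti numbers of the quotient of the complex [K] by the subcomplex [I]. *)
Definition rel_betti k m : Prop :=
  exists z : 'I_m -> K k,
  [/\ forall i, rel_cycle (z i),
      forall c, rel_cycle c ->
        exists (a : 'rV[F]_m) b, I (c - \sum_i a 0 i *: z i - d k b) &
      forall (a : 'rV[F]_m) b, I (\sum_i a 0 i *: z i - d k b) -> a = 0].

End Betti.

Section Cokernel.
Variables (I : forall k, K k -> Prop) (subI : subspaces I).
Hypothesis dI : forall k (c : K k.+1), I c -> I (d k c).
Variable T : forall k, {linear K k -> K k}.
Hypothesis dT : forall k c, d k (T k.+1 c) = T k (d k c).
Hypothesis TI : forall k (c : K k), I c -> I (T k c).
Hypothesis reg : forall k (c : K k), I (T k c) -> I c.
Variable h : forall k, {linear K k -> K k.+1}.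
Hypothesis hI : forall k (c : K k), I c -> I (h k c).
Hypothesis dh0 : forall c, d 0 (h 0 c) = T 0 c.
Hypothesis dhS : forall k c, d k.+1 (h k.+1 c) + h k (d k c) = T k.+1 c.

(** Modulo [I] this is the image of [T], so the quotient by it is the cokernel of [T] acting on the
    quotient by [I]. *)
Definition add_image k (c : K k) : Prop := exists a, I (c - T k a).

Lemma add_image_sub : subspaces add_image.
Proof.
move=> k; split=> [|a u v [b Ib] [c Ic]].
  by exists 0; rewrite linear0 subrr; exact: subspaces0.
exists (a *: b + c); rewrite linearP opprD addrACA -scalerBr.
by apply: subspacesD => //; exact: subspacesZ.
Qed.

Let IT k (c : K k) : I c -> add_image c.
Proof. by move=> Ic; exists 0; rewrite linear0 subr0. Qed.

(** In degree 0 the image of [T] already consists of boundaries, since [T = d h] there, so nothing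
    changes. *)
Lemma rel_betti_cokernel0 m : rel_betti I 0 m -> rel_betti add_image 0 m.
Proof.
move=> [z [zc zs zf]]; exists z; split=> // [c _|a b [e Ie]].
  by have [//|a [b Ib]] := zs c; exists a, b; exact: IT.
apply: (zf _ (b + h 0 e)); rewrite linearD /= dh0 opprD addrA; exact: Ie.
Qed.

(* The new cycles are the [h z] with [z] a cycle modulo [I] one degree lower:
   [d (h z) = T z] modulo [I]. *)
Lemma rel_betti_cokernelS k m m' :
  rel_betti I k.+1 m -> rel_betti I k m' ->
  rel_betti add_image k.+1 (m + m').
Proof.
move=> [z [zc zs zf]] [z' [zc' zs' zf']].
have Th c : rel_cycle I c -> I (T k c - d k (h k c)).
  case: k {z zc zs zf z' zc' zs' zf'} c => [|k] c.
    by rewrite dh0 subrr => _; exact: subspaces0.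
  by move=> /= Ic; rewrite -dhS addrC addKr; exact: hI.
pose w (i : 'I_(m + m')) :=
  match fintype.split i with inl i => z i | inr j => h k (z' j) end.
have wE (a : 'rV_m) (a' : 'rV_m') :
    \sum_i (row_mx a a') 0 i *: w i =
    \sum_i a 0 i *: z i + h k (\sum_i a' 0 i *: z' i).
  rewrite big_split_ord linear_sum; congr (_ + _); apply: eq_bigr => i _.
    by rewrite row_mxEl /w (unsplitK (inl i)).
  by rewrite row_mxEr /w (unsplitK (inr i)) linearZ.
have sumc (a' : 'rV_m') : rel_cycle I (\sum_i a' 0 i *: z' i).
  case: k z' zc' {z zc zs zf zs' zf' Th w wE} => //= k z' zc'.
  rewrite linear_sum; apply: subspaces_sum => // i.
  by rewrite linearZ; exact: subspacesZ.
exists w; split=> [i|c /= [a Ia]|a b [e Ie]].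
- rewrite /= /w; case: fintype.split => j; first exact/IT/(zc j).
  exists (z' j); rewrite -opprB; apply: (subspacesN subI); exact: Th.
(* The connecting map: [d c = T a] modulo [I], so [T (d a)] lies in [I], and injectivity of [T]
   modulo [I] makes [a] a cycle. *)
- have ac : rel_cycle I a.
    case: k a {z zc zs zf z' zc' zs' zf' w wE sumc Th} c Ia => //= k a c Ia.
    apply: reg; rewrite -dT -[X in I X]opprK; apply: (subspacesN subI).
    by rewrite -[- _]add0r -(dd c) -linearB; exact: dI.
  have [a' [b Ib]] := zs' a ac.
  set s' := \sum_i _ in Ib.
  (* As [a = s' + d b] modulo [I], and [d (h s') = T s'], this correction cancels [d c = T a]. *)
  have : rel_cycle I (c - h k s' - T k.+1 b).
    rewrite /= !linearB /= dT.
    have -> : d k c - d k (h k s') - T k (d k b) =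
        (d k c - T k a) + T k (a - s' - d k b) + (T k s' - d k (h k s')).
      rewrite !linearB /= -/s' !addrA subrK.
      by rewrite [RHS](ACl (1*5*3*2*4))/= subrK.
    apply: (subspacesD subI); last exact/Th/sumc.
    by apply: (subspacesD subI) => //; exact: TI.
  move=> /zs[a1 [b1 Ib1]]; exists (row_mx a1 a'), b1, b.
  rewrite wE -/s'; move: Ib1; congr (I _).
  by rewrite opprD !addrA [RHS](ACl (1*3*5*2*4)).
- rewrite -[a]hsubmxK wE in Ie *.
  set s := \sum_i _ in Ie; set s' := \sum_i _ in Ie.
  have ds : I (d k s).
    rewrite linear_sum; apply: subspaces_sum => // i.
    by rewrite linearZ; apply: subspacesZ => //; exact: zc.
  (* Applying [d] to the relation leaves [T s' = T (d e)] modulo [I], and [T] can be cancelled. *)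
  have Is' : I (s' - d k e).
    apply: reg; rewrite linearB /= -dT.
    have -> : T k s' - d k (T k.+1 e) =
        d k (s + h k s' - d k.+1 b - T k.+1 e) - d k s
        + (T k s' - d k (h k s')).
      rewrite !linearB linearD /= dd subr0 !addrA.
      by rewrite [RHS](ACl ((1*4)*(2*6)*5*3))/= !subrr !add0r.
    apply: (subspacesD subI); last exact/Th/sumc.
    by apply: (subspacesB subI) => //; exact: dI.
  have a'0 := zf' _ _ Is'.
  have s'0 : s' = 0.
    by rewrite /s' big1 // => i _; rewrite a'0 mxE scale0r.
  move: Is'; rewrite s'0 sub0r => /(subspacesN subI); rewrite opprK => de.
  rewrite a'0 (zf (lsubmx a) (b + h k.+1 e)) ?row_mx0 //.
  rewrite -/s; move: Ie; rewrite s'0 linear0 addr0 => Ie.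
  (* Now [d e] lies in [I], so [T e] is the boundary of [h e] modulo [I], and [s] is itself a
     boundary. *)
  have -> : s - d k.+1 (b + h k.+1 e) =
      (s - d k.+1 b - T k.+1 e) + h k (d k e).
    by rewrite -dhS linearD /= !opprD !addrA subrK.
  by apply: (subspacesD subI) => //; exact: hI.
Qed.

End Cokernel.
End RelativeHomology.

(** * Singular chains *)

Section SingularChains.
Variables (R : realType).

(** With [lift] and [unlift] turned into natural-number arithmetic, the simplicial identities become
    a matter for [lia]. *)
Lemma face_rowE k (i : 'I_k.+2) (x : 'rV[R]_k.+1) l :
  face_row i x 0 l = if l == i :> nat then 0 else x 0 (inord (l - (i < l)%N)).
Proof.
rewrite mxE; case: unliftP => [l' ->|->]; last by rewrite eqxx.
rewrite eq_sym (negbTE (neq_bump i l')); congr (x 0 _); apply/val_inj => /=.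
have := ltn_ord l'; have := ltn_ord i => hi /= hl.
by rewrite /bump inordK; lia.
Qed.

Lemma face_row_face k (i : 'I_k.+3) (j : 'I_k.+2) (x : 'rV[R]_k.+1) :
  (i <= j)%N ->
  face_row i (face_row j x) =
  face_row (inord j.+1 : 'I_k.+3) (face_row (inord i : 'I_k.+2) x).
Proof.
move=> ij; apply/rowP => l; rewrite !face_rowE.
have := (ltn_ord i, ltn_ord j, ltn_ord l) => -[[hi hj] hl].
rewrite !(inordK (m := j.+1)) // !(inordK (m := i)) //; last lia.
case: (eqVneq (l : nat) i) => [->|li]; case: (eqVneq (l : nat) j.+1) => [lj|lj].
all: rewrite ?inordK; try lia.
all: repeat case: ifP => ?; try lia; try by [].
all: try (congr (x 0 (inord _)); lia).
Qed.

Variable X : topologicalType.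
Local Notation C := (chain R X).

HB.instance Definition _ k := GRing.Linear.on (@boundary R X k).

Lemma boundaryU k (s : singular_simplex R X k.+1) :
  boundary << s >> = \sum_(i < k.+2) (-1) ^+ i *: (<< simplex_face s i >> : C k).
Proof. exact: fgliftU1. Qed.

Lemma simplex_face_face k (s : singular_simplex R X k.+2)
    (i : 'I_k.+3) (j : 'I_k.+2) : (i <= j)%N ->
  simplex_face (simplex_face s i) j =
  simplex_face (simplex_face s (inord j.+1)) (inord i).
Proof.
move=> ij; apply/continuousEP => x /=; congr (s _); apply/val_inj => /=.
exact: face_row_face.
Qed.

Lemma boundary_boundary k (c : C k.+2) : boundary (boundary c) = 0.
Proof.
elim/freeg_ind_sub: c => [|a u v u0 v0|s]; first by rewrite !linear0.
  by rewrite !linearP /= u0 v0 scaler0 addr0.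
rewrite boundaryU linear_sum /=.
under eq_bigr do rewrite linearZ /= boundaryU scaler_sumr.
under eq_bigr do under eq_bigr do rewrite scalerA -exprD.
rewrite pair_big /= (bigID (fun p : 'I_k.+3 * 'I_k.+2 => (p.1 <= p.2)%N)) /=.
apply/eqP; rewrite addr_eq0 -sumrN; apply/eqP.
(* [f] carries the pairs with [i <= j] onto those with [i > j], with inverse [g]; it pairs equal
   faces, and [j.+1] flips the sign. *)
pose f (p : 'I_k.+3 * 'I_k.+2) : 'I_k.+3 * 'I_k.+2 := (inord p.2.+1, inord p.1).
pose g (p : 'I_k.+3 * 'I_k.+2) : 'I_k.+3 * 'I_k.+2 := (inord p.2, inord p.1.-1).
rewrite [RHS](reindex_onto f g) /=; last first.
  move=> [i j] /=; rewrite -ltnNge => ji; rewrite /f /g /=.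
  have := (ltn_ord i, ltn_ord j) => -[hi hj].
  congr (_, _); apply/val_inj; rewrite /= ?(inordK (m := i.-1))
    ?(inordK (m:= j)) ?prednK ?inordK //; lia.
apply: eq_big => [[i j]|[i j]] /=; have := (ltn_ord i, ltn_ord j) => -[hi hj].
  rewrite /f /g xpair_eqE -!val_eqE /=.
  rewrite (inordK (m := j.+1)) //.
  case: (leqP i j) => ij.
    by rewrite !(inordK (m := i)) ?inord_val ?eqxx;  lia.
  apply/esym/negbTE/negP => /and3P[h /eqP e _].
  have := ltn_ord (inord i : 'I_k.+2) => hi'.
  by move: e; rewrite inordK; lia.
move=> ij; rewrite simplex_face_face // -scaleNr; congr (_ *: _).
by rewrite !inordK ?(leq_ltn_trans ij) // addSn exprS mulN1r opprK addnC.
Qed.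

Definition chain_mod k : lmodType rat := C k.

Definition boundary_map k : {linear chain_mod k.+1 -> chain_mod k} :=
  @boundary R X k.

Local Notation rbetti := (rel_betti boundary_map).

Definition zero_chains k (c : chain_mod k) : Prop := c = 0.

Lemma zero_chains_sub : subspaces zero_chains.
Proof.
by split=> // a u v; rewrite /zero_chains => -> ->; rewrite scaler0 addr0.
Qed.

(** Unique coordinates for every cycle amount to spanning plus independence: independence is
    uniqueness for the cycle 0, and conversely two coordinate vectors are compared through their
    difference. *)
Lemma is_bettiP k m : is_betti R X k m <-> rbetti zero_chains k m.
Proof.
split=> [[z zc zs]|[z [zc zs zf]]].
  exists z; split=> [i|c cc|a b ab].
  - by case: k z zc {zs} => // k z zc; exact: zc.
  - have [|a [[b ab] _]] := zs c; first by case: k c cc {z zc zs}.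
    by exists a, b; apply/eqP; rewrite subr_eq0 -ab.
  - have [|a0 [_ u]] := zs 0.
      by case: k {z zc zs a b ab} => //= k; rewrite linear0.
    have a00 : a0 = 0.
      apply: u; exists 0; rewrite linear0 sub0r big1 ?oppr0 // => i _.
      by rewrite mxE scale0r.
    rewrite -[LHS]opprK -(u (- a)) ?a00 ?oppr0 //.
    exists b; rewrite sub0r -sumrN; move/subr0_eq: ab => /esym.
    move=> ->; apply: eq_bigr => i _; by rewrite mxE scaleNr opprK.
exists z => [i|c cc]; first by have := zc i; case: k z {zc zs zf}.
have [|a [b ab]] := zs c; first by case: k c cc {z zc zs zf}.
exists a; split; first by exists b; move/subr0_eq: ab.
move=> a' [b' ab'].
apply/eqP; rewrite -subr_eq0; apply/eqP/(zf _ (b' - b)).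
have -> : \sum_i (a - a') 0 i *: z i =
    \sum_i a 0 i *: z i - \sum_i a' 0 i *: z i.
  by rewrite -sumrB; apply: eq_bigr => i _; rewrite !mxE scalerBl.
rewrite /zero_chains linearB /= ab'; move/subr0_eq: ab => /esym ->.
have E (V : zmodType) (u v w : V) : u - v - (w - v - (w - u)) = 0.
  rewrite !opprB [LHS](AC (2*(2*2)) ((1*4)*(5*2)*(3*6)))/=.
  by rewrite !subrr !addr0.
exact: E.
Qed.

End SingularChains.

(** * Uniqueness of Betti numbers and the Euler characteristic as a finite sum *)

Section BettiNumbers.

(** The coordinates of one basis in the other form an [m] by [m'] matrix with independent rows. Used
    in both directions, this identifies the value picked by [xget] in [betti]. *)
Lemma rel_betti_le (F : fieldType) (K : nat -> lmodType F)
    (d : forall k, {linear K k.+1 -> K k}) (I : forall k, K k -> Prop)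
    (subI : subspaces I) k m m' :
  rel_betti d I k m -> rel_betti d I k m' -> (m <= m')%N.
Proof.
move=> [z [zc _ zf]] [z' [_ zs' _]].
have /fin_all_exists[A zA] i : exists a : 'rV[F]_m',
    exists b, I k (z i - \sum_j a 0 j *: z' j - d k b).
  exact/zs'/zc.
have /fin_all_exists[b zb] := zA.
suff /eqP<- : row_free (\matrix_i A i) by exact: rank_leq_col.
apply: inj_row_free => v vA; apply: (zf _ (\sum_i v 0 i *: b i)).
have -> : \sum_i v 0 i *: z i - d k (\sum_i v 0 i *: b i) =
    \sum_i v 0 i *: (z i - \sum_j A i 0 j *: z' j - d k (b i)).
  rewrite linear_sum -!sumrB /=.
  under [RHS]eq_bigr do rewrite !scalerBr.
  rewrite !sumrB; congr (_ - _); last by under eq_bigr do rewrite linearZ.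
  rewrite [X in _ - X](_ : _ = 0) ?subr0 //.
  have -> : \sum_i v 0 i *: \sum_j A i 0 j *: z' j =
      \sum_i \sum_j (v 0 i * A i 0 j) *: z' j.
    apply: eq_bigr => i _; rewrite scaler_sumr.
    by apply: eq_bigr => j _; rewrite scalerA.
  rewrite exchange_big /= big1 // => j _.
  rewrite -scaler_suml; have /rowP/(_ j) := vA.
  rewrite !mxE => vj; rewrite (_ : \sum_i _ = 0) ?scale0r // -[RHS]vj.
  by apply: eq_bigr => i _; rewrite !mxE.
by apply: subspaces_sum => // i; apply: subspacesZ.
Qed.

Variables (R : realType) (X : topologicalType) (b : nat -> nat).
Hypothesis bX : forall k, is_betti R X k (b k).

Lemma betti_eq k : betti R X k = b k.
Proof.
apply: xget_subset1; first exact: bX.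
move=> m m' /is_bettiP bm /is_bettiP bm'; apply/eqP.
rewrite eqn_leq (rel_betti_le (@zero_chains_sub _ _) bm bm').
exact: (rel_betti_le (@zero_chains_sub _ _) bm' bm).
Qed.

Variable N : nat.
Hypothesis bN : forall k, (N <= k)%N -> b k = 0%N.

Lemma betti_finite_homology : finite_homology R X.
Proof.
split=> [k|]; first by exists (b k).
by exists N => k Nk; rewrite -(bN Nk).
Qed.

Lemma euler_charE : euler_char R X = \sum_(k < N) (-1) ^+ k * (b k)%:Z.
Proof.
under [RHS]eq_bigr do rewrite -betti_eq.
rewrite (fsbig_ord _ _ (fun k => (-1) ^+ k * (betti R X k)%:Z)).
apply/esym/fsbig_widen => // k [_ /= /negP]; rewrite -leqNgt => Nk.
by rewrite betti_eq bN // mulr0.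
Qed.

End BettiNumbers.

(** * Spaces with constant simplices *)

Section Simplex.
Variables (R : realType) (k : nat).

Lemma vertex_simplex : std_simplex R k (delta_mx 0 0).
Proof.
split=> [i|]; first by rewrite mxE ler0n.
rewrite (bigD1 ord0) //= big1 ?addr0 => [|i i0]; first by rewrite mxE !eqxx.
by rewrite mxE (negbTE i0) andbF.
Qed.

Definition vertex : std_simplex R k := 
  exist _ (delta_mx 0 0) (mem_set vertex_simplex).

End Simplex.

Lemma sum_sign_odd (R : pzRingType) n :
  \sum_(i < n) (-1) ^+ i = (odd n)%:R :> R.
Proof.
elim: n => [|n IHn]; first by rewrite big_ord0.
rewrite big_ord_recr /= IHn -signr_odd.
by case: (odd n); rewrite /= ?expr0 ?expr1 ?addrN ?add0r.
Qed.

Section ConstantSimplices.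
Variables (R : realType) (X : topologicalType).
Local Notation C := (chain R X).
Hypothesis cstX : forall k (s : singular_simplex R X k) x y, s x = s y.

(** With all simplices constant, each degree has one simplex per point. [shift] identifies
    consecutive degrees, and the boundary, an alternating sum of [k.+2] equal faces, becomes 0 or
    the identity according to the parity of [k]. *)
Let shift k : {linear C k -> C k.+1} :=
  fglift (fun s : singular_simplex R X k =>
    << (cst (s (vertex R k)) : singular_simplex R X k.+1) >>).

Let boundary_shift k (c : C k) : boundary (shift k c) = (odd k)%:R *: c.
Proof.
elim/freeg_ind_sub: c => [|a u v u0 v0|s]; first by rewrite !linear0.
  by rewrite !linearP /= u0 v0.
rewrite /shift /= fgliftU1 boundaryU.
have -> : (odd k)%:R = \sum_(i < k.+2) (-1) ^+ i :> rat.
  by rewrite sum_sign_odd /= negbK.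
rewrite scaler_suml; apply: eq_bigr => i _; congr (_ *: << _ >>).
by apply/continuousEP => x /=; exact: cstX.
Qed.

Let shift_boundary k (c : C k.+1) : shift k (boundary c) = (odd k)%:R *: c.
Proof.
elim/freeg_ind_sub: c => [|a u v u0 v0|s]; first by rewrite !linear0.
  by rewrite !linearP /= u0 v0.
have -> : (odd k)%:R = \sum_(i < k.+2) (-1) ^+ i :> rat.
  by rewrite sum_sign_odd /= negbK.
rewrite boundaryU linear_sum scaler_suml; apply: eq_bigr => i _.
rewrite linearZ /shift /= fgliftU1; congr (_ *: << _ >>).
by apply/continuousEP => x /=; exact: cstX.
Qed.

Lemma constant_bettiS k : is_betti R X k.+1 0.
Proof.
apply/is_bettiP; exists (fun=> 0); split=> [[]//|c /= cc|a b _]; last first.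
  by apply/rowP => -[].
(* For odd [k] the boundary is injective in degree [k.+1]; for even [k] every chain of that degree
   is the boundary of its shift. *)
exists 0; case: (boolP (odd k)) => ok.
  exists 0; rewrite linear0 subr0 big_ord0 subr0 /zero_chains.
  rewrite -[c]scale1r -[1]/(true%:R) -ok -shift_boundary.
  by rewrite [boundary c]cc linear0.
exists (shift _ c); rewrite big_ord0 subr0 /zero_chains /=.
by rewrite boundary_shift /= ok scale1r subrr.
Qed.

Lemma constant_betti0 N (f : 'I_N -> X) : bijective f -> is_betti R X 0 N.
Proof.
move=> [g fK gK]; pose p i : singular_simplex R X 0 := cst (f i).
have pI : injective p.
  move=> i j /continuousEP/(_ (vertex R 0)) /=; exact: can_inj fK _ _.
have pE (s : singular_simplex R X 0) : s = p (g (s (vertex R 0))).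
  by apply/continuousEP => x /=; rewrite gK; exact: cstX.
apply/is_bettiP; exists (fun i => << p i >>); split=> // [c _|a b].
  exists (\row_i coeff (p i) c), 0; rewrite linear0 subr0 /zero_chains.
  apply/eqP; rewrite subr_eq0; apply/eqP/eqP/freeg_eqP => s.
  rewrite raddf_sum /= (bigD1 (g (s (vertex R 0)))) //= big1 => [|i ig].
    by rewrite coeffZ coeffU mxE -pE eqxx !mulr1 addr0.
  rewrite coeffZ coeffU; case: eqP => [si|]; last by rewrite !mulr0.
  by move: ig; rewrite -si /= fK eqxx.
have -> : boundary_map R X 0 b = 0.
  rewrite /boundary_map /=; elim/freeg_ind_sub: b => [|x u v u0 v0|s].
  - by rewrite linear0.
  - by rewrite linearP /= u0 v0 scaler0 addr0.
  rewrite boundaryU !big_ord_recl big_ord0 addr0 expr0 expr1 scale1r scaleN1r.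
  apply/eqP; rewrite subr_eq0; apply/eqP; congr << _ >>.
  by apply/continuousEP => x /=; exact: cstX.
rewrite subr0 => a0; apply/rowP => i; rewrite mxE.
have := congr1 (coeff (p i)) a0; rewrite raddf0 raddf_sum /= (bigD1 i) //=.
rewrite big1 => [|j ji]; last first.
  by rewrite coeffZ coeffU (inj_eq pI) (negbTE ji) !mulr0.
by rewrite coeffZ coeffU eqxx !mulr1 addr0.
Qed.

End ConstantSimplices.

Lemma chain_ind (R : realType) (X : topologicalType) k
    (P : chain_mod R X k -> Prop) :
  P 0 -> (forall a u v, P u -> P v -> P (a *: u + v)) ->
  (forall s : singular_simplex R X k, P << s >>) -> forall u, P u.
Proof. exact: freeg_ind_sub. Qed.

Lemma chain_ext (R : realType) (X : topologicalType) k (M : lmodType rat)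
    (f g : {linear chain_mod R X k -> M}) :
  (forall s : singular_simplex R X k, f << s >> = g << s >>) -> f =1 g.
Proof. exact: freeg_lin_ext. Qed.

Section Pushforward.
Variables (R : realType) (X Y : topologicalType) (f : continuousType X Y).

Definition push k : {linear chain_mod R X k -> chain_mod R Y k} :=
  fglift (fun s : singular_simplex R X k =>
    << (f \o s : singular_simplex R Y k) >>).

Lemma pushU k (s : singular_simplex R X k) :
  push k << s >> = << (f \o s : singular_simplex R Y k) >>.
Proof. exact: fgliftU1. Qed.

Lemma boundary_push k c :
  boundary_map R Y k (push k.+1 c) = push k (boundary_map R X k c).
Proof.
apply: (@chain_ext _ _ _ _ (boundary_map R Y k \o push k.+1)
  (push k \o boundary_map R X k)) => s.
rewrite /= pushU /boundary_map /= !boundaryU linear_sum.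
apply: eq_bigr => i _; rewrite linearZ /= pushU; congr (_ *: << _ >>).
exact/continuousEP.
Qed.

End Pushforward.

(** * Cones and translations in a normed module *)

Lemma cvg_mx (K : numFieldType) (T : Type) (F : set_system T) (FF : Filter F)
    m n (f : T -> 'M[K]_(m, n)) (l : 'M[K]_(m, n)) :
  (forall i j, f x i j @[x --> F] --> l i j) -> f @ F --> l.
Proof.
move=> fl A [P lP PA].
suff : F (fun x => forall i j, P i j (f x i j)).
  by apply: (@filterS _ F) => x Px; exact: PA.
by apply: filter_forall => i; apply: filter_forall => j; exact: fl.
Qed.

Lemma continuous_within (T U : topologicalType) (f : T -> U) (D : set T) x :
  {for x, continuous f} -> f y @[y --> within D (nbhs x)] --> f x.
Proof. by move=> fx; exact: cvg_within_filter fx. Qed.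

Section StandardSimplex.
Variables (R : realType) (k : nat).

Lemma simplex_le1 (x : 'rV[R]_k.+1) i : std_simplex R k x -> x 0 i <= 1.
Proof.
move=> [x0 x1]; rewrite -x1 (bigD1 i) //= lerDl.
by apply: sumr_ge0 => j _; exact: x0.
Qed.

Lemma compact_simplex : compact (std_simplex R k).
Proof.
apply: bounded_closed_compact.
  exists 1; split=> [|M M1 x Dx]; first exact: num_real.
  apply: (le_trans _ (ltW M1)); rewrite [`|_|]mx_normrE.
  apply: bigmax_le => // -[i j] _ /=; rewrite (ord1 i).
  by rewrite ger0_norm ?simplex_le1 //; case: Dx.
rewrite (_ : std_simplex R k =
    (\bigcap_i [set x : 'rV[R]_k.+1 | 0 <= x 0 i]) `&`
    [set x : 'rV[R]_k.+1 | \sum_i x 0 i = 1]); last first.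
  by apply/seteqP; split=> x [x0 x1]; split=> // i *; exact: x0.
apply: closedI.
  apply: closed_bigI => i _.
  apply: (@preimage_closed _ _ (fun x : 'rV[R]_k.+1 => x 0 i) [set y | 0 <= y])
    => [x _|].
    exact: coord_continuous.
  exact: closed_ge.
apply: (@preimage_closed _ _ (fun x : 'rV[R]_k.+1 => \sum_i x 0 i) [set 1])
  => [x _|].
  by apply: continuous_big => [y|i _]; [exact: add_continuous|
    exact: coord_continuous].
exact: closed_eq.
Qed.

End StandardSimplex.

Section Cone.
Variables (R : realType) (V : normedModType R).

(** Central projection from vertex 0, in barycentric coordinates. *)
Definition opposite_face k (x : 'rV[R]_k.+2) : 'rV[R]_k.+1 :=
  (1 - x 0 0)^-1 *: \row_j x 0 (fintype.lift ord0 j).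

Lemma opposite_face_simplex k (x : 'rV[R]_k.+2) :
  std_simplex R k.+1 x -> x 0 0 != 1 -> std_simplex R k (opposite_face x).
Proof.
move=> Dx x01; have := simplex_le1 ord0 Dx; case: Dx => x0 x1 xle.
have xlt : 0 < 1 - x 0 0 by rewrite subr_gt0 lt_neqAle x01.
split=> [i|]; first by rewrite !mxE mulr_ge0 // invr_ge0 ltW.
under eq_bigr do rewrite !mxE.
rewrite -mulr_sumr -[X in _ * (X)](addKr (x 0 0)).
by rewrite -big_ord_recl x1 [- _ + 1]addrC mulVf // gt_eqF.
Qed.

Definition simplex_ext k (s : std_simplex R k -> V) (x : 'rV[R]_k.+1) : V :=
  'valL_0 s x.

Lemma simplex_extE k (s : std_simplex R k -> V) (x : std_simplex R k) :
  simplex_ext s (set_val x) = s x.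
Proof. by have := congr1 (fun f => f x) (valLK 0 s). Qed.

(* At the apex [x 0 0 = 1] the junk value of [opposite_face] has coefficient
   [0]. *)
Definition cone_fun k (p : V) (s : std_simplex R k -> V) (x : 'rV[R]_k.+2) :
    V :=
  x 0 0 *: p + (1 - x 0 0) *: simplex_ext s (opposite_face x).

Lemma cone_fun_continuous k p (s : singular_simplex R V k) :
  {within std_simplex R k.+1, continuous (cone_fun p s)}.
Proof.
have sc : {within std_simplex R k, continuous (simplex_ext s)}.
  by apply/subspace_valL_continuousP'; exact: cts_fun.
apply/subspace_continuousP => x Dx.
have x0c : (fun y : 'rV[R]_k.+2 => y 0 0) @
    within (std_simplex R k.+1) (nbhs x) --> x 0 0.
  by apply: continuous_within; exact: coord_continuous.
have wT : within (std_simplex R k.+1) (nbhs x) (std_simplex R k.+1).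
  exact: withinT.
have [x01|x01] := eqVneq (x 0 0) 1; last first.
  apply: cvgD; first exact: cvgZl.
  apply: cvgZ; first by apply: cvgB => //; exact: cvg_cst.
  apply: (cvg_comp (fun y : 'rV_k.+2 => opposite_face y) _
    (G := within (std_simplex R k) (nbhs (opposite_face x)))); last first.
    move/subspace_continuousP : sc; apply; exact: opposite_face_simplex.
  move=> A nA.
  have oc : opposite_face y @[y --> within (std_simplex R k.+1) (nbhs x)] -->
      opposite_face x.
    apply: cvgZ.
      apply: cvgV; first by rewrite subr_eq0 eq_sym.
      by apply: cvgB => //; exact: cvg_cst.
    apply: cvg_mx => i j; under eq_cvg do rewrite mxE; rewrite mxE.
    by apply: continuous_within; exact: coord_continuous.
  (* Away from the apex the first coordinate stays below 1, so the projection lands in the simplex,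
     where [s] is continuous. *)
  have x0lt : within (std_simplex R k.+1) (nbhs x)
      (fun y : 'rV[R]_k.+2 => y 0 0 < 1).
    by apply: (cvgr_lt _ x0c); rewrite lt_neqAle x01 simplex_le1.
  have ocA : within (std_simplex R k.+1) (nbhs x)
      (fun y => std_simplex R k (opposite_face y) -> A (opposite_face y)).
    exact: (oc _ nA).
  apply: filterS3 wT x0lt ocA => y Dy ylt; apply.
  by apply: opposite_face_simplex => //; rewrite lt_eqF.
(* At the apex the projection need not converge, but [s] is bounded on the compact simplex and its
   coefficient tends to 0. *)
have [M [Mreal sM]] :=
  compact_bounded (continuous_compact sc (@compact_simplex R k)).
apply: cvgD; first exact: cvgZl.
rewrite x01 subrr scale0r; apply: norm_cvg0.
apply: (@squeeze_cvgr _ _ _ _ (fun=> 0)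
  (fun y : 'rV[R]_k.+2 => `|1 - y 0 0| * (M + 1))).
- near=> y; rewrite normr_ge0 normrZ /=.
  have [->|y1] := eqVneq (y 0 0) 1; first by rewrite subrr normr0 !mul0r.
  rewrite ler_wpM2l //; apply: (sM (M + 1)); first by rewrite ltrDl.
  exists (opposite_face y) => //; apply: opposite_face_simplex => //.
  by near: y; exact: wT.
- exact: cvg_cst.
- have : (fun y : 'rV[R]_k.+2 => 1 - y 0 0) @
      within (std_simplex R k.+1) (nbhs x) --> (1 - x 0 0 : R).
    by apply: cvgB => //; exact: cvg_cst.
  rewrite x01 subrr => /cvg_norm; rewrite normr0 => x0n.
  by rewrite -[X in _ --> X](mul0r (M + 1)); exact: cvgMr_tmp.
Unshelve. all: by end_near. Qed.

End Cone.

Definition in_set_type (T : Type) (A : set T) x (Ax : A x) : A :=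
  exist _ x (mem_set Ax).

Section AffineChains.
Variables (R : realType) (V : normedModType R).
Local Notation K := (chain_mod R V).
Local Notation d := (boundary_map R V).

Lemma cone_continuous k p (s : singular_simplex R V k) :
  continuous (fun x : std_simplex R k.+1 => cone_fun p s (set_val x)).
Proof. exact/subspace_sigL_continuousP/cone_fun_continuous. Qed.

Definition cone_simplex k p (s : singular_simplex R V k) :
  singular_simplex R V k.+1 := mkcts (@cone_continuous k p s).

Lemma cone_face0 k p (s : singular_simplex R V k) :
  simplex_face (cone_simplex p s) ord0 = s.
Proof.
apply/continuousEP => x; rewrite /= /mkcts /cone_fun /= mxE unlift_none.
rewrite scale0r add0r subr0 scale1r -[RHS]simplex_extE; congr (simplex_ext s _).
rewrite /opposite_face mxE unlift_none subr0 invr1 scale1r.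
by apply/rowP => j; rewrite mxE face_row_lift.
Qed.

Lemma cone_faceS k p (s : singular_simplex R V k.+1) (i : 'I_k.+2) :
  simplex_face (cone_simplex p s) (fintype.lift ord0 i) =
  cone_simplex p (simplex_face s i).
Proof.
apply/continuousEP => x; rewrite /= /mkcts /cone_fun /=.
set y := set_val x.
have y0 : face_row (fintype.lift ord0 i) y 0 0 = y 0 0.
  by rewrite face_rowE /=; congr (y 0 _); apply/val_inj; rewrite /= inordK.
rewrite y0; congr (_ + _).
have [->|y1] := eqVneq (y 0 0) 1; first by rewrite subrr !scale0r.
pose z := in_set_type (opposite_face_simplex (set_valP x) y1).
rewrite -[opposite_face (set_val x)]/(set_val z).
rewrite simplex_extE /= -[s (face i z)]simplex_extE /=.
congr (_ *: simplex_ext s _).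
rewrite /opposite_face y0; apply/rowP => j.
rewrite [RHS]face_rowE [LHS]mxE [X in _ * X]mxE face_rowE.
rewrite /= /bump /= !add1n eqSS; case: ifP => ji; first by rewrite mulr0.
rewrite !mxE; congr (_ * y 0 _); apply/val_inj => /=.
have := (ltn_ord i, ltn_ord j) => -[hi hj].
by rewrite /bump /= !add1n !inordK ?ltnS; lia.
Qed.

Lemma cone_face1 p (s : singular_simplex R V 0) i :
  simplex_face (cone_simplex p s) (fintype.lift ord0 i) = cst p.
Proof.
apply/continuousEP => x; rewrite /= /mkcts /cone_fun /=.
have x1 : set_val x 0 0 = 1.
  by have [_] := set_valP x; rewrite big_ord_recl big_ord0 addr0.
rewrite face_rowE /= (_ : inord _ = ord0) ?x1; last exact/val_inj/inordK.
by rewrite subrr scale0r scale1r addr0.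
Qed.

Definition cone p k : {linear K k -> K k.+1} :=
  fglift (fun s : singular_simplex R V k => << cone_simplex p s >>).

Lemma coneU p k (s : singular_simplex R V k) :
  cone p k << s >> = << cone_simplex p s >>.
Proof. exact: fgliftU1. Qed.

Definition augmentation : {linear K 0 -> rat^o} :=
  fglift (fun s : singular_simplex R V 0 => 1 : rat^o).

Definition aug (c : K 0) : rat := augmentation c.

Lemma augmentation_boundary c : augmentation (d 0 c) = 0.
Proof.
elim/chain_ind: c => [|a u v u0 v0|s]; first by rewrite !linear0.
  by rewrite !linearP /= u0 v0 scaler0 addr0.
rewrite /boundary_map /= boundaryU !big_ord_recl big_ord0 addr0 expr0 expr1.
by rewrite linearD !linearZ /= /augmentation /= !fgliftU1 scale1r scaleN1r subrr.
Qed.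

Lemma boundary_cone0 p c :
  d 0 (cone p 0 c) = c - aug c *: (<< cst p : singular_simplex R V 0 >> : K 0).
Proof.
elim/chain_ind: c => [|a u v u0 v0|s].
- by rewrite /aug !linear0 scale0r subr0.
- rewrite !linearP /= u0 v0 /aug linearP scalerBr scalerDl scalerA opprD.
  by rewrite addrACA.
rewrite coneU /boundary_map /= boundaryU !big_ord_recl big_ord0 addr0 expr0.
rewrite cone_face0 cone_face1 expr1 scale1r /aug /augmentation /= fgliftU1.
by rewrite scaleN1r scale1r.
Qed.

Lemma boundary_coneS p k c : d k.+1 (cone p k.+1 c) = c - cone p k (d k c).
Proof.
elim/chain_ind: c => [|a u v u0 v0|s].
- by rewrite !linear0 addr0.
- by rewrite !linearP /= u0 v0 scalerDr addrACA.
rewrite coneU /boundary_map /= !boundaryU big_ord_recl expr0 scale1r cone_face0.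
rewrite linear_sum -sumrN; congr (_ + _); apply: eq_bigr => i _.
by rewrite cone_faceS linearZ /= coneU exprS mulN1r scaleNr.
Qed.

(** Coning from 0 gives the homology of a point; the binomial form is the base case of
    [coinv_betti]. *)
Lemma affine_betti k : rel_betti d (@zero_chains R V) k 'C(0, k).
Proof.
case: k => [|k].
  exists (fun=> << cst 0 : singular_simplex R V 0 >>); split=> // [c _|a b].
    exists (\row__ aug c), (cone 0 0 c); rewrite /zero_chains.
    by rewrite boundary_cone0 big_ord1 mxE subrr.
  rewrite big_ord1 => /(congr1 augmentation).
  rewrite linear0 linearB /= augmentation_boundary subr0 linearZ /=.
  rewrite /augmentation /= fgliftU1 => a0; apply/rowP => i.
  by rewrite (ord1 i) mxE -[LHS]mulr1.
exists (fun=> 0); split=> [[]//|c cc|a b _]; last by apply/rowP => -[].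
exists 0, (cone 0 _ c); rewrite /zero_chains boundary_coneS big_ord0 subr0.
by rewrite [d k c]cc linear0 subr0 subrr.
Qed.

Section Translation.
Variable v : V.

Lemma translation_continuous : continuous (fun x : V => v + x).
Proof. by move=> x; apply: cvgD; [exact: cvg_cst | exact: cvg_id]. Qed.

Definition translation : continuousType V V := mkcts translation_continuous.

End Translation.

Definition trans v k : {linear K k -> K k} := push R (translation v) k.

Lemma transU v k (s : singular_simplex R V k) :
  trans v k << s >> = << translation v \o s : singular_simplex R V k >>.
Proof. exact: pushU. Qed.

Lemma transA v w k c : trans v k (trans w k c) = trans (v + w) k c.
Proof.
apply: (@chain_ext _ _ _ _ (trans v k \o trans w k) (trans (v + w) k)) => s.
rewrite /= !transU; congr << _ >>; apply/continuousEP => x /=.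
by rewrite /mkcts addrA.
Qed.

Lemma trans0 k c : trans 0 k c = c.
Proof.
apply: (@chain_ext _ _ _ _ (trans 0 k) idfun) => s.
rewrite /= transU; congr << _ >>; apply/continuousEP => x /=.
by rewrite /mkcts add0r.
Qed.

(** The two weights of the cone add up to 1, so a translation passes through it and moves the apex
    along. *)
Lemma trans_cone v p k c :
  trans v k.+1 (cone p k c) = cone (v + p) k (trans v k c).
Proof.
apply: (@chain_ext _ _ _ _ (trans v k.+1 \o cone p k)
  (cone (v + p) k \o trans v k)) => s.
rewrite /= coneU !transU coneU; congr << _ >>; apply/continuousEP => x /=.
rewrite /mkcts /cone_fun /=; set y := set_val x.
have [->|y1] := eqVneq (y 0 0) 1; first by rewrite subrr !scale0r !scale1r !addr0.
pose z := in_set_type (opposite_face_simplex (set_valP x) y1).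
rewrite -[opposite_face y]/(set_val z).
rewrite !simplex_extE /= /mkcts !scalerDr addrACA -scalerDl.
by rewrite [_ + (1 - _)]addrC subrK scale1r.
Qed.

Definition trans_sub v k : {linear K k -> K k} := trans v k \- idfun.

Lemma boundary_trans v k c : d k (trans v k.+1 c) = trans v k (d k c).
Proof. exact: boundary_push. Qed.

Lemma boundary_trans_sub v k c :
  d k (trans_sub v k.+1 c) = trans_sub v k (d k c).
Proof. by rewrite /= linearB /= boundary_trans. Qed.

Lemma trans_trans_sub v w k c :
  trans v k (trans_sub w k c) = trans_sub w k (trans v k c).
Proof. by rewrite /= linearB /= !transA [v + w]addrC. Qed.

(* Taking the first vertex of the simplex as the apex makes the homotopy commute
   with all translations. *)
Fixpoint trans_homotopy v k : {linear K k -> K k.+1} :=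
  match k with
  | 0 => fglift (fun s : singular_simplex R V 0 =>
      cone (s (vertex R 0)) 0 (trans_sub v 0 << s >>))
  | k.+1 => fglift (fun s : singular_simplex R V k.+1 =>
      cone (s (vertex R k.+1)) k.+1
        (trans_sub v k.+1 << s >> - trans_homotopy v k (d k << s >>)))
  end.

Lemma trans_homotopyU0 v (s : singular_simplex R V 0) :
  trans_homotopy v 0 << s >> =
  cone (s (vertex R 0)) 0 (trans_sub v 0 << s >>).
Proof. exact: fgliftU1. Qed.

Lemma trans_homotopyUS v k (s : singular_simplex R V k.+1) :
  trans_homotopy v k.+1 << s >> =
  cone (s (vertex R k.+1)) k.+1
    (trans_sub v k.+1 << s >> - trans_homotopy v k (d k << s >>)).
Proof. exact: fgliftU1. Qed.

Lemma trans_homotopy_trans v w k c :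
  trans w k.+1 (trans_homotopy v k c) = trans_homotopy v k (trans w k c).
Proof.
elim: k c => [|k IHk].
  apply: (@chain_ext _ _ _ _ (trans w _ \o trans_homotopy v _)
    (trans_homotopy v _ \o trans w _)) => s.
  rewrite -[LHS]/(trans w 1 (trans_homotopy v 0 << s >>)).
  rewrite -[RHS]/(trans_homotopy v 0 (trans w 0 << s >>)).
  by rewrite transU !trans_homotopyU0 trans_cone trans_trans_sub transU.
apply: (@chain_ext _ _ _ _ (trans w _ \o trans_homotopy v _)
  (trans_homotopy v _ \o trans w _)) => s.
rewrite -[LHS]/(trans w k.+2 (trans_homotopy v k.+1 << s >>)).
rewrite -[RHS]/(trans_homotopy v k.+1 (trans w k.+1 << s >>)).
rewrite transU !trans_homotopyUS trans_cone linearB trans_trans_sub IHk.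
by rewrite -boundary_trans transU.
Qed.

Lemma boundary_trans_homotopy0 v c :
  d 0 (trans_homotopy v 0 c) = trans_sub v 0 c.
Proof.
apply: (@chain_ext _ _ _ _ (d 0 \o trans_homotopy v 0) (trans_sub v 0)) => s.
rewrite -[LHS]/(d 0 (trans_homotopy v 0 << s >>)) trans_homotopyU0.
rewrite boundary_cone0 /= transU /aug linearB /=.
by rewrite /augmentation /= !fgliftU1 subrr scale0r subr0.
Qed.

(** The chain coned off in degree [k.+1] is a cycle, by the homotopy identity one degree lower;
    hence the second term of [boundary_coneS] vanishes. *)
Lemma boundary_trans_homotopyS v k c :
  d k.+1 (trans_homotopy v k.+1 c) + trans_homotopy v k (d k c) =
  trans_sub v k.+1 c.
Proof.
elim: k c => [|k IHk] c.
all: apply: (@chain_ext _ _ _ _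
  ((d _ \o trans_homotopy v _) \+ (trans_homotopy v _ \o d _))
  (trans_sub v _)) => s.
all: set x : chain_mod R V _ := << s >>.
all: have dhd : d _ (trans_homotopy v _ (d _ x)) = trans_sub v _ (d _ x).
- exact: boundary_trans_homotopy0.
- rewrite -[LHS]/(d 1 (trans_homotopy v 1 x) + trans_homotopy v 0 (d 0 x)).
  rewrite trans_homotopyUS -/x boundary_coneS (linearB (d 0)) dhd.
  by rewrite boundary_trans_sub subrr linear0 subr0 subrK.
- by rewrite -IHk [d k _]boundary_boundary linear0 addr0.
- rewrite -[LHS]/(d k.+2 (trans_homotopy v k.+2 x) +
    trans_homotopy v k.+1 (d k.+1 x)).
  rewrite trans_homotopyUS -/x boundary_coneS (linearB (d k.+1)) dhd.
  by rewrite boundary_trans_sub subrr linear0 subr0 subrK.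
Qed.

End AffineChains.

(** * Coinvariants under commuting translations *)

Section Coinvariants.
Variables (R : realType) (V : normedModType R) (n : nat).
Variables (e : nat -> V) (u : nat -> V -> R).
Hypothesis uD : forall j x y, u j (x + y) = u j x + u j y.
Hypothesis ue : forall j l, (j < n)%N -> (l < n)%N -> u j (e l) = (j == l)%:R.
Local Notation K := (chain_mod R V).
Local Notation d := (boundary_map R V).
Local Notation T l := (trans_sub (e l)).

Let uMn j x m : u j (x *+ m) = u j x *+ m.
Proof.
elim: m => [|m IHm]; last by rewrite !mulrS uD IHm.
by apply: (@addrI _ (u j (x *+ 0))); rewrite -uD !mulr0n !addr0.
Qed.

(** The sum of the images of [T 0], ..., [T j.-1], nested so that each stage is the cokernel step of
    [rel_betti_cokernelS]. *)
Fixpoint coinv j : forall k, K k -> Prop :=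
  if j is i.+1 then add_image (coinv i) (T i) else @zero_chains R V.

Lemma coinv_sub j : subspaces (coinv j).
Proof.
by elim: j => [|j IHj]; [exact: zero_chains_sub | exact: add_image_sub].
Qed.

Lemma coinv_stable j k k' (f : {linear K k -> K k'}) :
  (forall l c, f (T l k c) = T l k' (f c)) ->
  forall c, coinv j c -> coinv j (f c).
Proof.
move=> fT; elim: j => [c|j IHj c [a ca]].
  by rewrite /= /zero_chains => ->; rewrite linear0.
by exists (f a); rewrite -fT -linearB; exact: IHj.
Qed.

Lemma coinv_boundary j k (c : K k.+1) : coinv j c -> coinv j (d k c).
Proof.
by apply: (coinv_stable (f := d k)) => l b; rewrite boundary_trans_sub.
Qed.

Lemma coinv_trans_sub j v k (c : K k) : coinv j c -> coinv j (trans_sub v k c).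
Proof.
apply: (coinv_stable (f := trans_sub v k)) => l b.
rewrite /= !(linearB (trans _ _)) /= !transA [e l + v]addrC.
by rewrite !opprB [LHS]addrACA [RHS]addrACA; congr (_ + _); rewrite addrC.
Qed.

Lemma coinv_homotopy j v k (c : K k) :
  coinv j c -> coinv j (trans_homotopy v k c).
Proof.
apply: (coinv_stable (f := trans_homotopy v k)) => l b.
by rewrite /= linearB /= -trans_homotopy_trans.
Qed.

(* [unwind j] projects onto the simplices whose first vertex has its [j]-th
   coordinate in [0, 1[. It is not a chain map, but it turns the coinvariants
   under [e j] into a submodule of chains, which makes [T l] injective there. *)
Definition wind j k (s : singular_simplex R V k) : int :=
  Num.floor (u j (s (vertex R k))).

Definition unwind j k : {linear K k -> K k} :=
  fglift (fun s : singular_simplex R V k => trans (- e j *~ wind j s) k << s >>).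

Lemma unwindU j k (s : singular_simplex R V k) :
  unwind j k << s >> = trans (- e j *~ wind j s) k << s >>.
Proof. exact: fgliftU1. Qed.

Lemma unwind_trans_sub j k c : (j < n)%N -> unwind j k (T j k c) = 0.
Proof.
move=> jn; elim/chain_ind: c => [|a x y x0 y0|s]; first by rewrite !linear0.
  by rewrite !linearP /= x0 y0 scaler0 addr0.
rewrite /trans_sub /= transU linearB /= !unwindU.
have -> : wind j (translation (e j) \o s : singular_simplex R V k) = wind j s + 1.
  rewrite /wind /= /mkcts uD ue // eqxx addrC -[_ + 1]/(_ + 1%:~R).
  by rewrite floorDrz ?intrKfloor // intr_int.
by rewrite -transU transA mulrzDr mulr1z subrK subrr.
Qed.

Lemma unwind_trans_subC j l k c : (j < n)%N -> (l < n)%N -> j != l ->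
  unwind j k (T l k c) = T l k (unwind j k c).
Proof.
move=> jn ln jl; elim/chain_ind: c => [|a x y x0 y0|s]; first by rewrite !linear0.
  by rewrite !linearP /= x0 y0.
rewrite /trans_sub /= transU linearB /= !unwindU.
have -> : wind j (translation (e l) \o s : singular_simplex R V k) = wind j s.
  by rewrite /wind /= /mkcts uD ue // (negbTE jl) add0r.
by rewrite -transU !transA [e l + _]addrC.
Qed.

(** In the group ring $\tau^m-1$ is a multiple of $\tau-1$. A negative exponent is reduced to a
    positive one acting on a translated chain. *)
Lemma trans_mulz_sub v (m : int) k (c : K k) :
  exists a, trans (v *~ m) k c - c = trans_sub v k a.
Proof.
have nat_case (p : nat) c' : exists a, trans (v *+ p) k c' - c' = trans_sub v k a.
  elim: p => [|p [a IHp]].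
    by exists 0; rewrite mulr0n trans0 subrr linear0.
  exists (trans (v *+ p) k c' + a).
  rewrite linearD -IHp [trans_sub _ _ _]/(_ - _) transA -mulrS.
  by rewrite addrA subrK.
case: m => p; first exact: nat_case.
have [a ap] := nat_case p.+1 (trans (v *~ Negz p) k c).
exists (- a); rewrite linearN -ap transA NegzE mulrNz subrr trans0 opprB.
by [].
Qed.

Lemma unwind_coinv j k (c : K k) : exists a, c - unwind j k c = T j k a.
Proof.
elim/chain_ind: c => [|b x y [a xa] [a' ya']|s].
- by exists 0; rewrite !linear0 addr0.
- exists (b *: a + a').
  rewrite (_ : T j k _ = b *: T j k a + T j k a'); last exact: linearP.
  by rewrite -xa -ya' (linearP (unwind j k)) /= opprD addrACA scalerBr.
rewrite unwindU mulNrz -mulrNz.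
have [a sa] := trans_mulz_sub (e j) (- wind j s) << s >>.
by exists (- a); rewrite linearN -sa opprB.
Qed.

(** A chain fixed by the translation has constant coefficients along its orbits; these are infinite,
    since [u l] separates the multiples of [e l], while supports are finite. *)
Lemma trans_sub_inj l k c : (l < n)%N -> T l k c = 0 -> c = 0.
Proof.
move=> ln Tc0.
have coeff_tr v (s : singular_simplex R V k) (b : K k) :
    coeff (translation v \o s : singular_simplex R V k) (trans v k b) =
    coeff s b.
  elim/chain_ind: b => [|a x y x0 y0|s'].
  - by rewrite linear0 !coeff0.
  - by rewrite linearP /= !coeffD !coeffZ x0 y0.
  rewrite transU !coeffU; congr (_ * (nat_of_bool _)%:R).
  apply/eqP/eqP => [|->//] /continuousEP ss'; apply/continuousEP => x.
  exact: (addrI v (ss' x)).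
have c1 (s : singular_simplex R V k) m :
    coeff (translation (e l *+ m) \o s : singular_simplex R V k) c = coeff s c.
  elim: m => [|m IHm].
    by congr coeff; apply/continuousEP => x; rewrite /= /mkcts mulr0n add0r.
  rewrite -IHm -[in RHS](coeff_tr (e l)); move/subr0_eq: Tc0 => ->.
  congr coeff; apply/continuousEP => x /=.
  by rewrite /mkcts /= /mkcts mulrS addrA.
apply/eqP; rewrite -dom_eq0; case D: (dom c) => [//|s r].
have sc : coeff s c != 0 by rewrite -mem_dom D mem_head.
pose t m : singular_simplex R V k := translation (e l *+ m) \o s.
have tI : injective t.
  move=> m m' /continuousEP/(_ (vertex R k)) /= /addIr.
  move=> /(congr1 (u l)); rewrite !uMn ue // eqxx => /eqP.
  by rewrite eqr_nat => /eqP.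
suff : (size [seq t m | m <- iota 0 (size (dom c)).+1] <= size (dom c))%N.
  by rewrite size_map size_iota ltnn.
apply: uniq_leq_size; first by rewrite map_inj_uniq ?iota_uniq.
by move=> _ /mapP[m _ ->]; rewrite mem_dom c1.
Qed.

(** [unwind j] kills the image of [T j], preserves the earlier images, and differs from the identity
    by an element of the image of [T j]. *)
Lemma coinvS_unwind j k (c : K k) : (j < n)%N ->
  coinv j.+1 c <-> coinv j (unwind j k c).
Proof.
move=> jn; have [a ca] := unwind_coinv j c; split=> [[b cb]|uc]; last first.
  by exists a; rewrite -ca subKr.
have stable i x : (i <= j)%N -> coinv i x -> coinv i (unwind j k x).
  elim: i x => [|i IHi] x ij; first rewrite /= /zero_chains.
    by move=> ->; rewrite linear0.
  move=> [y xy]; exists (unwind j k y).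
  rewrite -unwind_trans_subC ?(ltn_trans ij) ?gtn_eqF // -linearB.
  exact/IHi/xy/ltnW.
have := stable j _ (leqnn j) cb.
by rewrite linearB /= -/(T j k b) unwind_trans_sub // subr0.
Qed.

(** [unwind] removes the directions below [j] one at a time and commutes with [T l], which leaves
    injectivity on chains. Only [l = j] is used later; the induction keeps [l] fixed while [j]
    decreases. *)
Lemma coinv_regular j l k (c : K k) : (j <= l < n)%N ->
  coinv j (T l k c) -> coinv j c.
Proof.
elim: j k c => [|j IHj] k c /andP[jl ln]; first exact: trans_sub_inj.
have jn := ltn_trans jl ln.
move=> /(coinvS_unwind _ jn); rewrite unwind_trans_subC ?ltn_eqF // => uc.
by apply/coinvS_unwind => //; apply: IHj uc; rewrite ltnW.
Qed.

(** The recursion of [rel_betti_cokernelS] is Pascal's rule. *)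
Lemma coinv_betti j k : (j <= n)%N -> rel_betti d (coinv j) k 'C(j, k).
Proof.
elim: j k => [|j IHj] k jn; first exact: affine_betti.
case: k => [|k].
  rewrite bin0 -(bin0 j).
  apply: (rel_betti_cokernel0 (boundary_trans_homotopy0 (e j))).
  exact/IHj/ltnW.
rewrite binS; apply: (rel_betti_cokernelS _ _ _ _ _ _ _
  (boundary_trans_homotopy0 (e j)) (boundary_trans_homotopyS (e j))).
- by move=> i c; exact: boundary_boundary.
- exact: coinv_sub.
- by move=> i c; exact: coinv_boundary.
- by move=> i c; exact: boundary_trans_sub.
- by move=> i c; exact: coinv_trans_sub.
- by move=> i c; apply: coinv_regular; rewrite leqnn.
- by move=> i c; exact: coinv_homotopy.
- exact/IHj/ltnW.
- exact/IHj/ltnW.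
Qed.

Lemma coinv_lattice j (m : nat -> int) k (c : K k) :
  coinv j (trans (\sum_(i < j) e i *~ m i) k c - c).
Proof.
elim: j c => [|j IHj] c.
  by rewrite big_ord0 trans0 subrr; exact: (subspaces0 (@zero_chains_sub R V)).
rewrite big_ord_recr /= -transA.
have [a ca] := trans_mulz_sub (e j) (m j) c.
exists a; rewrite -ca opprB addrA subrK; exact: IHj.
Qed.

End Coinvariants.

(** * Chains of the base of a covering as coinvariants *)

Section Covering.
Variables (R : realType) (V : normedModType R) (n : nat).
Variables (e : nat -> V) (u : nat -> V -> R).
Hypothesis uD : forall j x y, u j (x + y) = u j x + u j y.
Hypothesis ue : forall j l, (j < n)%N -> (l < n)%N -> u j (e l) = (j == l)%:R.
Variables (X : topologicalType) (p : continuousType V X).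
Hypothesis p_inv : forall j x, (j < n)%N -> p (e j + x) = p x.
Hypothesis p_lift : forall k (s : singular_simplex R X k),
  exists s' : singular_simplex R V k, p \o s' = s :> (_ -> _).
Hypothesis p_fiber : forall k (s s' : singular_simplex R V k),
  p \o s = p \o s' :> (_ -> _) ->
  exists m : nat -> int, forall x, s x = \sum_(i < n) e i *~ m i + s' x.

Local Notation f := (push R p).

(** For the converse, a choice of lifts gives a linear section [L] of [f], not a chain map;
    [c - L (f c)] is a combination of differences of two lifts of one simplex, which are lattice
    translates. *)
Lemma push_coinv k (c : chain_mod R V k) : coinv e n c <-> f k c = 0.
Proof.
split=> [|fc0].
  suff H j (b : chain_mod R V k) : (j <= n)%N -> coinv e j b -> f k b = 0.
    exact: H.
  elim: j b => [|j IHj] b jn; first rewrite /= /zero_chains.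
    by move=> ->; rewrite linear0.
  move=> [a /(IHj _ (ltnW jn))]; rewrite linearB => /subr0_eq ->.
  elim/chain_ind: a => [|r x y x0 y0|s]; first by rewrite !linear0.
    rewrite (_ : trans_sub (e j) k _ =
        r *: trans_sub (e j) k x + trans_sub (e j) k y).
      by rewrite linearP /= x0 y0 scaler0 addr0.
    exact: linearP.
  rewrite /trans_sub /= transU linearB /= !pushU; apply/eqP.
  rewrite subr_eq0; apply/eqP; congr << _ >>; apply/continuousEP => x /=.
  exact: p_inv.
have [l pl] : exists l : singular_simplex R X k -> singular_simplex R V k,
    forall s, p \o l s = s :> (_ -> _).
  by have [l lP] := boolp.choice (@p_lift k); exists l.
pose L : {linear chain_mod R X k -> chain_mod R V k} :=
  fglift (fun s : singular_simplex R X k => << l s >>).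
suff: coinv e n (c - L (f k c)) by rewrite fc0 linear0 subr0.
elim/chain_ind: {fc0} c => [|a x y x0 y0|s].
- by rewrite !linear0 addr0; exact: (subspaces0 (coinv_sub e n)).
- rewrite (linearP (f k)) (linearP L) /= opprD addrACA -scalerBr.
  by case: (coinv_sub e n k) => _; apply.
rewrite pushU /L /= fgliftU1.
set t := l _; have pst : p \o s = p \o t :> (_ -> _) by rewrite /t pl.
have [m mP] := p_fiber pst.
have -> : s = translation (\sum_(i < n) e i *~ m i) \o t :> singular_simplex R V k.
  by apply/continuousEP.
rewrite -transU; exact: coinv_lattice.
Qed.

Lemma push_surj k (c : chain_mod R X k) : exists b, f k b = c.
Proof.
elim/chain_ind: c => [|a x y [b <-] [b' <-]|s].
- by exists 0; rewrite linear0.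
- by exists (a *: b + b'); rewrite linearP.
have [s' ps'] := p_lift s; exists << s' >>; rewrite pushU; congr << _ >>.
by apply/continuousEP => x; rewrite -ps'.
Qed.

Lemma covering_betti k : is_betti R X k 'C(n, k).
Proof.
have [z [zc zs zf]] := coinv_betti uD ue k (leqnn n).
have fd i (c : chain_mod R V i.+1) :
    boundary_map R X i (f _ c) = f _ (boundary_map R V i c).
  exact: boundary_push.
apply/is_bettiP; exists (fun i => f k (z i)); split=> [i|c cc|a b].
- case: k z zc i {zs zf} => //= k z zc i; rewrite /zero_chains fd.
  exact/push_coinv/zc.
- have [b bc] := push_surj c.
  have [|a [b' ab']] := zs b.
    case: k c cc b bc {z zc zs zf} => [//|k] c cc b bc.
    by rewrite /rel_cycle; apply/push_coinv; rewrite -fd bc.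
  exists a, (f _ b'); rewrite /zero_chains fd -bc; move/push_coinv: ab'.
  rewrite !linearB /= linear_sum => ab'; rewrite -[RHS]ab'; congr (_ - _ - _).
  by apply: eq_bigr => i _; rewrite linearZ.
have [b' <-] := push_surj b; rewrite fd => ab.
apply: (zf a b'); apply/push_coinv; rewrite linearB /= linear_sum -[RHS]ab.
by congr (_ - _); apply: eq_bigr => i _; rewrite linearZ.
Qed.

End Covering.

(** * Lifting simplices of the circle and of the torus *)

Section Turns.
Variable R : realType.

(** Angles are counted in turns, so that the period is 1. *)
Definition cost (x : R) : R := cos (pi *+ 2 * x).
Definition sint (x : R) : R := sin (pi *+ 2 * x).

Lemma cost_sintDn x (m : nat) :
  cost (x + m%:R) = cost x /\ sint (x + m%:R) = sint x.
Proof.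
rewrite /cost /sint mulrDr mulr_natr.
by split; apply: periodicn; [exact: cosD2pi | exact: sinD2pi].
Qed.

Lemma cost_sintDz x (m : int) :
  cost (x + m%:~R) = cost x /\ sint (x + m%:~R) = sint x.
Proof.
case: m => m; first exact: cost_sintDn.
have [c s] := cost_sintDn (x + (Negz m)%:~R) m.+1.
by move: c s; rewrite NegzE mulrNz subrK.
Qed.

(** The fractional part [z] of [x - y] has cosine 1 by the subtraction formula. Written as
    $1-2\sin^2(\pi z)$, this forces [z = 0], because the sine is positive on $]0,\pi[$. *)
Lemma cost_sint_inj x y : cost x = cost y -> sint x = sint y ->
  exists m : int, x = y + m%:~R.
Proof.
move=> cxy sxy; exists (Num.floor (x - y)); set m := Num.floor _.
pose z := x - y - m%:~R.
suff z0 : z = 0.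
  by apply/eqP; rewrite -subr_eq0 opprD addrA; apply/eqP.
have z_ge0 : 0 <= z by rewrite subr_ge0 floor_le.
have z_lt1 : z < 1.
  by rewrite ltrBlDr [1 + _]addrC -[1]/(1%:~R) -intrD; exact: floorD1_gt.
have cz : cost z = 1.
  have := (cost_sintDz z m).1; rewrite subrK => <-.
  rewrite /cost mulrBr cosB -/(cost x) -/(cost y) -/(sint x) -/(sint y).
  by rewrite cxy sxy -!expr2 cos2Dsin2.
apply: contra_eq cz => z0.
have -> : cost z = 1 - sin (pi * z) ^+ 2 *+ 2.
  rewrite /cost mulrnAl mulr2n cosD -!expr2.
  by rewrite cos2sin2 mulr2n opprD addrA.
have zpi : 0 < sin (pi * z).
  have z_gt0 : 0 < z by rewrite lt_neqAle eq_sym z0.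
  by apply: sin_gt0_pi; rewrite mulr_gt0 ?pi_gt0 //= gtr_pMr ?pi_gt0.
by rewrite lt_eqF // ltrBlDr ltrDl pmulrn_rgt0 // exprn_gt0.
Qed.

Lemma continuous_cost : continuous cost.
Proof.
move=> x; apply: continuous_comp; last exact: continuous_cos.
exact: mulrl_continuous.
Qed.

Lemma continuous_sint : continuous sint.
Proof.
move=> x; apply: continuous_comp; last exact: continuous_sin.
exact: mulrl_continuous.
Qed.

End Turns.

(** Heine's theorem for continuity relative to [A]: locally one [delta] serves all nearby points,
    and near-covering compactness makes it global. *)
Lemma compact_unif (R : realType) (V : normedModType R) (A : set V) (g : V -> R) :
  compact A -> {within A, continuous g} -> forall eps : R, 0 < eps ->
  exists2 delta : R, 0 < delta &
    forall x y, A x -> A y -> `|x - y| < delta -> `|g x - g y| < eps.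
Proof.
move=> /compact_near_coveringP/near_covering_withinP cA gc eps eps0.
pose P (delta : R) x := forall y, A y -> `|x - y| < delta -> `|g x - g y| < eps.
have : \forall delta \near 0^'+, A `<=` P delta.
  apply: cA => x Ax.
  have /cvgrPdist_lt/(_ (eps / 2)) gx : g y @[y --> within A (nbhs x)] --> g x.
    by move/subspace_continuousP : gc; apply.
  have /nbhs_ballP[eta /= eta0 etaP] := gx (divr_gt0 eps0 (ltr0Sn _ 1)).
  near=> x' delta => Ax' y Ay xy.
  have xx' : `|x - x'| < eta / 2.
    near: x'; apply/nbhs_normP; exists (eta / 2) => //=; exact: divr_gt0.
  have de : delta < eta / 2 by near: delta; apply: nbhs_right_lt; exact: divr_gt0.
  have b1 : ball x eta x'.
    rewrite -ball_normE /=; apply: (lt_trans xx').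
    by rewrite ltr_pdivrMr // ltr_pMr // ltr1n.
  have b2 : ball x eta y.
    rewrite -ball_normE /= -(subrK x' x) -addrA (le_lt_trans (ler_normD _ _)) //.
    by rewrite [eta]splitr ltrD // (lt_trans xy).
  have := etaP _ b1 Ax'; have := etaP _ b2 Ay => /= gy gx'.
  rewrite -(subrK (g x) (g x')) -addrA (le_lt_trans (ler_normD _ _)) //.
  by rewrite [eps]splitr ltrD // distrC.
move=> dP; near (0 : R)^'+ => delta; exists delta => [//|x y Ax Ay].
by apply: (near dP delta) => //.
Unshelve. all: by end_near. Qed.

Lemma cvg_affine (K : numFieldType) (V : normedModType K) (T : Type)
    (F : set_system T) (FF : Filter F) (f : T -> V) (l a : V) (c : K) :
  f @ F --> l -> a + c *: f x @[x --> F] --> a + c *: l.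
Proof. by move=> fl; apply: cvgD; [exact: cvg_cst | exact: cvgZl_tmp]. Qed.

Section Segments.
Variables (R : realType) (k : nat).
Local Notation D := (std_simplex R k).

Lemma simplex_convex (x y : 'rV[R]_k.+1) (t : R) : D x -> D y -> 0 <= t <= 1 ->
  D ((1 - t) *: x + t *: y).
Proof.
move=> [x0 x1] [y0 y1] /andP[t0 t1]; split=> [i|].
  by rewrite !mxE addr_ge0 // mulr_ge0 // subr_ge0.
under eq_bigr do rewrite !mxE.
by rewrite big_split /= -!mulr_sumr x1 y1 !mulr1 subrK.
Qed.

(** Truncation lets [segment] accept any real parameter and still stay in the simplex. *)
Definition clamp (t : R) : R := Num.max 0 (Num.min t 1).

Lemma clamp_itv t : 0 <= clamp t <= 1.
Proof. by rewrite /clamp le_max lexx ge_max ler01 ge_min lexx orbT. Qed.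

Lemma clamp_id t : 0 <= t <= 1 -> clamp t = t.
Proof. by move=> /andP[t0 t1]; rewrite /clamp (min_idPl t1) (max_idPr t0). Qed.

Lemma continuous_clamp : continuous clamp.
Proof.
move=> t; rewrite -[clamp]/(cst 0 \max (id \min cst 1)).
apply: continuous_max; first exact: cvg_cst.
by apply: continuous_min; [exact: cvg_id | exact: cvg_cst].
Qed.

Definition segment (x y : D) (t : R) : D :=
  in_set_type (simplex_convex (set_valP x) (set_valP y) (clamp_itv t)).

Lemma segmentE x y t : set_val (segment x y t) =
  (1 - clamp t) *: set_val x + clamp t *: set_val y.
Proof. by []. Qed.

Lemma segment0 x y : segment x y 0 = x.
Proof.
by apply/val_inj; rewrite /= clamp_id ?lexx ?ler01 // subr0 scale1r scale0r addr0.
Qed.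

Lemma segment1 x y : segment x y 1 = y.
Proof.
by apply/val_inj; rewrite /= clamp_id ?lexx ?ler01 // subrr scale1r scale0r add0r.
Qed.

Lemma segment_continuousr x y : continuous (segment x y).
Proof.
apply: continuous_comp_initial => t /=.
apply: cvgD; apply: cvgZr_tmp; last exact: continuous_clamp.
by apply: cvgB; [exact: cvg_cst | exact: continuous_clamp].
Qed.

Lemma segment_continuousl x t : continuous (segment x ^~ t).
Proof.
apply: continuous_comp_initial => y.
pose g (z : 'rV[R]_k.+1) := (1 - clamp t) *: set_val x + clamp t *: z.
have gc : continuous g.
  by move=> z; apply: (@cvg_affine _ _ _ (nbhs z)); exact: cvg_id.
apply: (@continuous_comp _ _ _ (set_val : D -> _) g); last exact: gc.
exact: initial_continuous.
Qed.

(** Otherwise the values along a segment would, by the intermediate value theorem, include an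
    integer plus one half. *)
Lemma integer_valued_constant (f : D -> R) : continuous f ->
  (forall x, exists m : int, f x = m%:~R) -> forall x y, f x = f y.
Proof.
move=> fc fZ x y.
wlog : x y / f x <= f y.
  by move=> W; case: (leP (f x) (f y)) => [|/ltW] /W.
rewrite le_eqVlt => /orP[/eqP //|fxy].
have [a fa] := fZ x; have [b fb] := fZ y.
have ab : (a + 1 <= b)%R by rewrite lezD1 -(ltr_int R) -fa -fb.
have gc : {within `[0, 1], continuous (f \o segment x y)}.
  apply: continuous_subspaceT => t.
  by apply: continuous_comp; [exact: segment_continuousr | exact: fc].
have half : f x + 2^-1 <= f y.
  rewrite fa fb (le_trans _ (_ : (a + 1)%:~R <= _)) ?ler_int //.
  by rewrite intrD lerD2l invf_le1 // ler1n.
have [|c _ /= fc'] := IVT ler01 gc (v := f x + 2^-1).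
- rewrite /= segment0 segment1 (min_idPl (ltW fxy)) (max_idPr (ltW fxy)) half.
  by rewrite lerDl invr_ge0 ler0n.
have [m] := fZ (segment x y c); rewrite fc' fa => am.
have : (a - m)%:~R * 2 + 1 = 0 :> R by rewrite intrB; lra.
rewrite -[2]/(2%:~R) -intrM -[X in _ + X]/(1%:~R) -intrD => /eqP.
rewrite intr_eq0 => /eqP; lia.
Qed.

End Segments.

Section CircleLift.
Variables (R : realType) (k : nat).
Local Notation D := (std_simplex R k).
Variables (c s : D -> R) (theta0 : R).
Hypotheses (cc : continuous c) (sc : continuous s).
Hypothesis cs1 : forall x, c x ^+ 2 + s x ^+ 2 = 1.
Hypotheses (c0 : cos theta0 = c (vertex R k)) (s0 : sin theta0 = s (vertex R k)).

Let unif (f : D -> R) : continuous f -> forall eps : R, 0 < eps ->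
  exists2 delta : R, 0 < delta &
    forall x y : D, `|set_val x - set_val y| < delta -> `|f x - f y| < eps.
Proof.
move=> fc eps eps0.
have fw : {within D, continuous (@simplex_ext R R k f)}.
  exact/subspace_valL_continuousP'.
have [delta d0 dP] := compact_unif (@compact_simplex R k) fw eps0.
exists delta => // x y xy; rewrite -(@simplex_extE R R) -[f y](@simplex_extE R R).
by apply: dP => //; exact: set_valP.
Qed.

(* The angle is accumulated along the segment from the base vertex, cut into
   pieces along which the point turns by less than a right angle. *)
Lemma circle_lift : exists theta : D -> R,
  [/\ continuous theta, forall x, cos (theta x) = c x &
      forall x, sin (theta x) = s x].
Proof.
have h0 : 0 < 2^-1 :> R by rewrite invr_gt0 ltr0n.
have [d1 d10 d1P] := unif cc h0; have [d2 d20 d2P] := unif sc h0.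
(* 2 bounds the distance from the base vertex, so [N] equal pieces are shorter than both moduli of
   continuity. *)
have [N N0 ND] : exists2 N, (0 < N)%N & 2 / N%:R < Num.min d1 d2.
  exists (Num.bound (2 / Num.min d1 d2)).+1 => //.
  have d0 : 0 < Num.min d1 d2 by rewrite lt_min d10.
  rewrite ltr_pdivrMr ?ltr0n // mulrC -ltr_pdivrMr //.
  apply: (lt_trans (archi_boundP _)); first by rewrite divr_ge0 // ltW.
  by rewrite ltr_nat.
pose v := vertex R k; pose q x (i : nat) : D := segment v x (i%:R / N%:R).
have qs x i : (i < N)%N -> `|set_val (q x i.+1) - set_val (q x i)| < Num.min d1 d2.
  move=> iN; apply: le_lt_trans ND.
  have iN01 j : (j <= N)%N -> 0 <= (j%:R / N%:R : R) <= 1.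
    move=> jN; apply/andP; split; first by rewrite divr_ge0.
    by rewrite ler_pdivrMr ?ltr0n // mul1r ler_nat.
  rewrite /q !segmentE !clamp_id ?iN01 //; last exact: ltnW.
  have -> : forall (a b : R) (u w : 'rV[R]_k.+1),
      (1 - a) *: u + a *: w - ((1 - b) *: u + b *: w) = (a - b) *: (w - u).
    by move=> a b u w; apply/rowP => j; rewrite !mxE; ring.
  rewrite -mulrBl -natrB // subSnn normrZ mul1r mulrC gtr0_norm ?invr_gt0 ?ltr0n //.
  rewrite ler_pM2r ?invr_gt0 ?ltr0n //.
  rewrite [`|_|]mx_normrE; apply: bigmax_le => // -[i' j] _ /=.
  rewrite (ord1 i') !mxE.
  have := simplex_le1 j (set_valP x); have [/(_ j) + _] := set_valP x => xj0 xj1.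
  by case: (_ && _) => /=; rewrite ler_norml; apply/andP; split; lra.
(* Cosine and sine of the turn from [q x i] to [q x i.+1]. *)
pose C x i := c (q x i.+1) * c (q x i) + s (q x i.+1) * s (q x i).
pose S x i := s (q x i.+1) * c (q x i) - c (q x i.+1) * s (q x i).
have CS x i : C x i ^+ 2 + S x i ^+ 2 = 1.
  rewrite -[RHS](mulr1 1) -{1}(cs1 (q x i.+1)) -(cs1 (q x i)) /C /S; ring.
(* The squared chord is [2 - 2 * C x i]; with both coordinates moving by less than 1/2 it stays
   below 1/2. *)
have C0 x i : (i < N)%N -> 0 < C x i.
  move=> iN; have := qs x i iN; rewrite lt_min => /andP[/d1P + /d2P].
  rewrite !ltr_norml => /andP[c1 c2] /andP[s1 s2].
  have := cs1 (q x i.+1); have := cs1 (q x i); rewrite /C.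
  move: (c _) (c _) (s _) (s _) c1 c2 s1 s2 => c1 c2 s1 s2 h1 h2 h3 h4 h5 h6.
  nra.
(* Strict bounds give continuity of [asin] there, and the sign of [C x i] gives
   [cos (asin (S x i)) = C x i]. *)
have S1 x i : (i < N)%N -> -1 < S x i < 1.
  move=> iN; rewrite -ltr_norml -(@ltr_pXn2r _ 2) ?nnegrE // expr1n.
  by rewrite real_normK ?num_real // -(CS x i) ltrDr exprn_gt0 // C0.
pose th j x := theta0 + \sum_(i < N | (i < j)%N) asin (S x i).
have thP x j : (j <= N)%N ->
    cos (th j x) = c (q x j) /\ sin (th j x) = s (q x j).
  elim: j => [_|j IHj jN].
    by rewrite /th big_pred0 // addr0 /q mul0r segment0.
  have [cj sj] := IHj (ltnW jN).
  have -> : th j.+1 x = th j x + asin (S x j).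
    rewrite /th -addrA; congr (_ + _).
    rewrite (bigD1 (Ordinal jN)) ?ltnSn //= addrC; congr (_ + _).
    by apply: eq_bigl => i; rewrite ltnS [(i < j)%N]ltn_neqAle andbC.
  have /andP[S1' S2'] := S1 x j jN.
  have sa : sin (asin (S x j)) = S x j by rewrite asinK // in_itv /= !ltW.
  have ca : cos (asin (S x j)) = C x j.
    rewrite cos_asin ?ltW // -(CS x j) addrK sqrtr_sqr ger0_norm // ltW //.
    exact: C0.
  rewrite cosD sinD cj sj sa ca /C /S; split.
    by rewrite -[RHS]mulr1 -(cs1 (q x j)); ring.
  by rewrite -[RHS]mulr1 -(cs1 (q x j)); ring.
exists (th N); split=> [x|x|x].
- apply: (@cvgD _ _ _ (nbhs x)); first exact: cvg_cst.
  have qc i : continuous (q ^~ i) by exact: segment_continuousl.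
  apply: (@cvg_big _ _ _ _ _ _ _ (nbhs x)) => [|i _]; first exact: add_continuous.
  apply: (continuous_comp (f := fun y => S y i)); last exact/continuous_asin/S1.
  have fq (f : D -> R) j : continuous f -> continuous (fun y => f (q y j)).
    by move=> fc y; apply: continuous_comp; [exact: qc | exact: fc].
  by apply: (@cvgB _ _ _ (nbhs x)); apply: (@cvgM _ _ (nbhs x)); exact: fq.
- by rewrite (thP x N (leqnn N)).1 /q divff ?segment1 // pnatr_eq0 -lt0n.
- by rewrite (thP x N (leqnn N)).2 /q divff ?segment1 // pnatr_eq0 -lt0n.
Qed.

End CircleLift.

Section TorusCovering.
Variables (R : realType) (n : nat).
Local Notation V := ('rV[R]_n * 'rV[R]_n)%type.
Variables (X : topologicalType) (p : continuousType V X).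
Variables (C S W : 'I_n -> X -> R).
Hypotheses (Cc : forall j, continuous (C j)) (Sc : forall j, continuous (S j))
  (Wc : forall j, continuous (W j)).
Hypotheses (Cp : forall j v, C j (p v) = cost (v.1 0 j))
  (Sp : forall j v, S j (p v) = sint (v.1 0 j))
  (Wp : forall j v, W j (p v) = v.2 0 j).
Hypothesis p_surj : forall x, exists v, p v = x.
Hypothesis p_periodic : forall v w : V,
  (forall j, exists m : int, v.1 0 j = w.1 0 j + m%:~R) -> v.2 = w.2 -> p v = p w.

(** Each circle coordinate is lifted by [circle_lift], while [W] is read off directly. The space [X]
    is abstract because it will be the torus itself as well as the fixed locus of the identity. *)
Lemma torus_lift k (s : singular_simplex R X k) :
  exists s' : singular_simplex R V k, p \o s' = s :> (_ -> _).
Proof.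
have comp_cont (f : X -> R) : continuous f -> continuous (f \o s).
  by move=> fc x; apply: continuous_comp; [exact: cts_fun | exact: fc].
have twopi : pi *+ 2 != 0 :> R by rewrite mulrn_eq0 /= gt_eqF // pi_gt0.
have /boolp.choice[theta thetaP] j : exists theta : std_simplex R k -> R,
    [/\ continuous theta, forall x, cos (theta x) = C j (s x) &
      forall x, sin (theta x) = S j (s x)].
  have [v vs] := p_surj (s (vertex R k)).
  apply: (circle_lift (comp_cont _ (@Cc j)) (comp_cont _ (@Sc j))
    (theta0 := pi *+ 2 * v.1 0 j)) => [x||] /=.
  - by have [w <-] := p_surj (s x); rewrite Cp Sp cos2Dsin2.
  - by rewrite -vs Cp.
  - by rewrite -vs Sp.
pose f1 (x : std_simplex R k) : 'rV[R]_n := \row_j ((pi *+ 2)^-1 * theta j x).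
pose f2 (x : std_simplex R k) : 'rV[R]_n := \row_j W j (s x).
have f1c : continuous f1.
  move=> x; apply: (@cvg_mx _ _ (nbhs x)) => i j.
  under eq_cvg do rewrite mxE; rewrite mxE.
  by apply: (@cvgMl_tmp _ _ (nbhs x)); case: (thetaP j) => + _ _; apply.
have f2c : continuous f2.
  move=> x; apply: (@cvg_mx _ _ (nbhs x)) => i j.
  under eq_cvg do rewrite mxE; rewrite mxE.
  exact: (comp_cont _ (@Wc j)).
have fc : continuous (fun x => (f1 x, f2 x) : V).
  by move=> x; exact: cvg_pair (f1c x) (f2c x).
exists (mkcts fc); apply/funext => x /=.
have [v vs] := p_surj (s x); rewrite -vs; apply: p_periodic => [j|].
  apply: cost_sint_inj; rewrite /= mxE /cost /sint mulVKf //.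
    by have [_ -> _] := thetaP j; rewrite -vs Cp.
  by have [_ _ ->] := thetaP j; rewrite -vs Sp.
by apply/rowP => j; rewrite mxE -vs Wp.
Qed.

Definition torus_period (j : nat) : V := (\row_i (i == j :> nat)%:R, 0).

Lemma torus_periods (m : nat -> int) :
  \sum_(i < n) torus_period i *~ m i = (\row_i (m i)%:~R, 0).
Proof.
rewrite [LHS]surjective_pairing; congr (_, _).
  rewrite (raddf_sum (@fst _ _)) /=; apply/rowP => j.
  rewrite summxE (bigD1 j) //= big1 => [|i ij].
    by rewrite (raddfMz (@fst _ _)) /= -scaler_int !mxE eqxx mulr1 addr0.
  rewrite (raddfMz (@fst _ _)) /= -scaler_int !mxE.
  by rewrite (inj_eq val_inj) eq_sym (negbTE ij) mulr0.
rewrite (raddf_sum (@snd _ _)) /= big1 // => i _.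
by rewrite (raddfMz (@snd _ _)) /= mul0rz.
Qed.

(** The first components of two lifts differ by continuous integer-valued functions, hence by
    constants; the second ones agree because [W] only depends on the image in [X]. *)
Lemma torus_fiber k (s s' : singular_simplex R V k) :
  p \o s = p \o s' :> (_ -> _) ->
  exists m : nat -> int,
    forall x, s x = \sum_(i < n) torus_period i *~ m i + s' x.
Proof.
move=> ss'; have {}ss' x : p (s x) = p (s' x) by have := congr1 (fun f => f x) ss'.
have Z j x : exists m : int, (s x).1 0 j - (s' x).1 0 j = m%:~R.
  have [||m ->] := @cost_sint_inj R ((s x).1 0 j) ((s' x).1 0 j).
  - by rewrite -!Cp ss'.
  - by rewrite -!Sp ss'.
  by exists m; rewrite addrC addKr.
have cst j x y : (s x).1 0 j - (s' x).1 0 j = (s y).1 0 j - (s' y).1 0 j.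
  have sc (t : singular_simplex R V k) : continuous (fun x => (t x).1 0 j).
    have t1 : continuous (fun x => (t x).1).
      by move=> z; apply: continuous_comp; [exact: cts_fun | exact: cvg_fst].
    move=> z; have := @continuous_comp _ _ _ (fun x => (t x).1)
      (fun M : 'rV[R]_n => M 0 j) z (t1 z).
    by apply; exact: coord_continuous.
  apply: (integer_valued_constant (f := fun x => (s x).1 0 j - (s' x).1 0 j)) => // z.
  by apply: (@cvgB _ _ _ (nbhs z)); exact: sc.
have /boolp.choice[m mP] (j : 'I_n) := Z j (vertex R k).
pose m' i : int := if insub i is Some j then m j else 0; exists m' => x.
rewrite torus_periods [LHS]surjective_pairing; congr (_, _).
  by apply/rowP => j; rewrite !mxE /m' valK -mP (cst j _ x) subrK.
by apply/rowP => j; rewrite !mxE add0r -!Wp ss'.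
Qed.

Lemma torus_betti k : is_betti R X k 'C(n, k).
Proof.
(* The [j]-th real coordinate, as a sum so that [j] can be any natural number. *)
pose u (j : nat) (v : V) : R := \sum_(i < n | i == j :> nat) v.1 0 i.
apply: (@covering_betti _ _ n torus_period u _ _ _ p).
- by move=> j x y; rewrite /u -big_split; apply: eq_bigr => i _; rewrite mxE.
- move=> j l jn ln; rewrite /u (big_pred1 (Ordinal jn)) ?mxE //.
- move=> j x jn; apply: p_periodic => [i|]; last by rewrite /= add0r.
  by exists ((i == j :> nat)%:R : int); rewrite !mxE addrC; case: (_ == _).
- exact: torus_lift.
- exact: torus_fiber.
Qed.

End TorusCovering.

(** * The index of an integer matrix *)

Section LatticeIndex.
Variables (K : numFieldType) (n : nat).

Definition integral m (v : 'cV[K]_m) : Prop :=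
  exists z : 'cV[int]_m, v = map_mx intr z.

Lemma integral_mul m (P : 'M[int]_m) v : integral v -> integral (map_mx intr P *m v).
Proof. by move=> [z ->]; exists (P *m z); rewrite map_mxM. Qed.

Lemma integral_mulK m (P : 'M[int]_m) v : P \in unitmx ->
  integral (map_mx intr P *m v) -> integral v.
Proof.
move=> uP /(integral_mul (invmx P)).
by rewrite mulmxA -map_mxM mulVmx // map_mx1 mul1mx.
Qed.

(** The [y i] represent $M^{-1}\mathbb Z^n/\mathbb Z^n$. In the Smith form $M=PDQ$ the factor $P$
    preserves integrality and $Q$ is a change of lattice basis, so only the diagonal matters. *)
Lemma lattice_index (M : 'M[int]_n) : \det M != 0 ->
  exists y : 'I_`|\det M| -> 'cV[K]_n,
  [/\ forall i, integral (map_mx intr M *m y i),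
      forall i j, integral (y i - y j) -> i = j &
      forall v, integral (map_mx intr M *m v) -> exists i, integral (v - y i)].
Proof.
move=> detM; have [P uP [Q uQ [s _ Ms]]] := int_Smith_normal_form M.
set D := \matrix_(_, _) _ in Ms.
have DE : D = diag_mx (\row_i s`_i).
  by apply/matrixP => i j; rewrite !mxE.
have norm_unit (U : 'M[int]_n) : U \in unitmx -> `|\det U|%N = 1%N.
  move=> uU; have := congr1 (fun A : 'M[int]_n => `|\det A|%N) (mulmxV uU).
  by rewrite det_mulmx det1 abszM => /eqP; rewrite muln_eq1 => /andP[/eqP].
have detD : `|\det M|%N = (\prod_(i < n) `|(s`_i)%R|)%N.
  rewrite Ms !det_mulmx !abszM (norm_unit P) // (norm_unit Q) //.
  rewrite mul1n muln1 DE det_diag.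
  rewrite (big_morph absz abszM (erefl : `|1 : int|%N = 1%N)).
  by apply: eq_bigr => i _; rewrite mxE.
have s0 i : s`_(i : 'I_n) != 0.
  move: detM; rewrite -absz_gt0 detD; apply: contraTneq => si.
  by rewrite (bigD1 i) //= si absz0 mul0n.
have sK0 i : (s`_(i : 'I_n))%:~R != 0 :> K by rewrite intr_eq0.
pose fT := {dffun forall i : 'I_n, 'I_`|(s`_i)%R|%N}.
have cardT : #|{: fT}| = `|\det M|%N.
  rewrite card_dep_ffun detD foldrE big_map big_enum /=.
  by apply: eq_bigr => i _; rewrite card_ord.
(* Representatives of $\frac1{s_i}\mathbb Z/\mathbb Z$ in each coordinate; [s] may have negative
   entries, hence the absolute values. *)
pose w (f : fT) : 'cV[K]_n := \col_i ((f i)%:R / (s`_i)%:~R).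
pose yf f := map_mx intr (invmx Q) *m w f.
have QK m (v : 'M[K]_(n, m)) : map_mx intr Q *m (map_mx intr (invmx Q) *m v) = v.
  by rewrite mulmxA -map_mxM mulmxV // map_mx1 mul1mx.
have MQ (v : 'cV[K]_n) : integral (map_mx intr M *m v) <->
    forall i : 'I_n, exists m : int, (s`_i)%:~R * (map_mx intr Q *m v) i 0 = m%:~R.
  have DQ i : (map_mx intr D *m (map_mx intr Q *m v)) i 0 =
      (s`_i)%:~R * (map_mx intr Q *m v) i 0.
    by rewrite DE map_diag_mx mul_diag_mx !mxE.
  rewrite Ms !map_mxM -!mulmxA; split=> [/(integral_mulK uP)[z zE] i|zE].
    by exists (z i 0); rewrite -DQ zE mxE.
  apply: integral_mul; have [z zP] := boolp.choice zE; exists (\col_i z i).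
  by apply/colP => i; rewrite DQ zP !mxE.
suff [y1 y2 y3] : [/\ forall f, integral (map_mx intr M *m yf f),
      forall f f', integral (yf f - yf f') -> f = f' &
      forall v, integral (map_mx intr M *m v) -> exists f, integral (v - yf f)].
  rewrite -cardT; exists (fun i => yf (enum_val i)); split=> [i|i j|v].
  - exact: y1.
  - by move/y2; exact: enum_val_inj.
  - by move=> /y3[f vf]; exists (enum_rank f); rewrite enum_rankK.
split=> [f|f f'|v].
- apply/MQ => i; rewrite QK mxE; exists (f i : nat).
  by rewrite mulrC divfK.
- move=> /(integral_mul Q); rewrite mulmxBr !QK => -[z zE].
  apply/ffunP => i; apply/val_inj => /=.
  have /colP/(_ i) := zE; rewrite !mxE -mulrBl => /(canRL (divfK (sK0 i))).
  rewrite !pmulrn -intrB -intrM => /intr_inj fE.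
  have := ltn_ord (f i); have := ltn_ord (f' i) => f'i fi.
  have : (`|(f i : int) - (f' i : int)| < `|(s`_i)%R|)%N by lia.
  rewrite fE abszM; case: (z i 0 =P 0) => [z0|/eqP z0].
    by move=> _; move: fE; rewrite z0 mul0r => /subr0_eq [].
  by rewrite -absz_gt0 in z0; rewrite ltnNge leq_pmull.
move/MQ/boolp.choice => [m mP].
have ms i : (`|(m i %% s`_i)%Z| < `|(s`_i)%R|)%N.
  by rewrite -ltz_nat !abszE ger0_norm ?modz_ge0 // ltz_mod.
exists [ffun i => Ordinal (ms i)]; apply: (integral_mulK uQ).
rewrite mulmxBr QK; exists (\col_i (m i %/ s`_i)%Z).
apply/colP => i; apply: (mulfI (sK0 i)).
move: (map_mx intr Q *m v) mP => qv mP.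
rewrite !mxE mulrBr mP ffunE /=.
rewrite mulrCA divff // mulr1 pmulrn gez0_abs ?modz_ge0 //.
by rewrite {1}(divz_eq (m i) s`_i) intrD addrK intrM mulrC.
Qed.

End LatticeIndex.

(** * Cyclotomic polynomials *)

Section CyclotomicPolynomials.

Lemma prod_Cyclotomic_gt1 n : (0 < n)%N ->
  \prod_(d <- divisors n | (1 < d)%N) 'Phi_d = \sum_(i < n) 'X^i.
Proof.
move=> n0; have Phi1 : 'Phi_1 = 'X - 1.
  by have := prod_Cyclotomic (ltn0Sn 0); rewrite big_seq1 expr1.
apply: (@mulfI _ ('X - 1)); first by rewrite polyXsubC_eq0.
rewrite -{1}Phi1 -subrX1 -prod_Cyclotomic //.
rewrite [RHS](bigD1_seq 1%N) ?divisors_uniq // -?dvdn_divisors //=.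
congr (_ * _); rewrite big_seq_cond [RHS]big_seq_cond; apply: eq_bigl => d.
rewrite -dvdn_divisors //; case: d => [|[|d]] //.
by rewrite dvd0n; case: n n0 {Phi1}.
Qed.

(** At 1 the product of the ['Phi_d] over the divisors [d > 1] of [n] equals [n], and by induction
    its other factors are positive. This later removes the absolute value of the determinant. *)
Lemma Cyclotomic1_gt0 n : (1 < n)%N -> 0 < ('Phi_n).[1].
Proof.
elim/ltn_ind: n => n IHn n1; have n0 := ltnW n1.
have /(congr1 (horner^~ 1)) := prod_Cyclotomic_gt1 n0.
have -> : (\sum_(i < n) 'X^i : {poly int}).[1] = n%:R.
  rewrite horner_sum; under eq_bigr do rewrite hornerXn expr1n.
  by rewrite sumr_const card_ord.
rewrite horner_prod -big_filter (bigD1_seq n) ?filter_uniq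
  ?divisors_uniq //=; last first.
  by rewrite mem_filter n1 -dvdn_divisors ?dvdnn.
set q := \prod_(i <- _ | _) _ => qn.
have q0 : 0 < q.
  rewrite /q big_seq_cond; apply: prodr_gt0 => d.
  rewrite mem_filter -dvdn_divisors // => /andP[/andP[d1 dn] dn'].
  by apply: IHn => //; rewrite ltn_neqAle dn' dvdn_leq.
by rewrite -(pmulr_lgt0 _ q0) qn ltr0n.
Qed.

(** Any root has minimal polynomial ['Phi_d] over the rationals, which therefore divides [p];
    dividing it out lowers the size. *)
Lemma primitive_roots_Cyclotomic d (p : {poly rat}) : p \is monic ->
  (forall z : algC, root (map_poly ratr p) z -> d.-primitive_root z) ->
  exists m, p = map_poly intr 'Phi_d ^+ m.
Proof.
move: {2}(size p).+1 (ltnSn (size p)) => N; elim: N => // N IHN in p *.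
move=> sp p_mon pz; have [p1|p1] := leqP (size p) 1.
  exists 0%N; rewrite expr0; have /size1_polyC pE := p1.
  by move: p_mon; rewrite pE monicE lead_coefC => /eqP ->.
have [z rz] : exists z : algC, root (map_poly ratr p) z.
  by apply/closed_rootP; rewrite size_map_poly gtn_eqF.
have zd := pz z rz; have [q [qE q_mon] qP] := minCpolyP z.
have qPhi : q = map_poly intr 'Phi_d.
  apply: (map_inj_poly (fmorph_inj ratr) (rmorph0 (ratr : rat -> algC))).
  rewrite -qE (minCpoly_cyclotomic zd) -(Cintr_Cyclotomic zd) -map_poly_comp.
  by apply: eq_map_poly => a /=; rewrite rmorph_int.
move: rz; rewrite qP => /dvdpP[r pE].
have r_mon : r \is monic by rewrite -(monicMr r q_mon) -pE.
have [|w rw|m rE] := IHN r _ r_mon.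
- rewrite -ltnS; apply: leq_trans sp; rewrite pE ltnS size_Mmonic ?monic_neq0 //.
  have q1 : (1 < size q)%N.
    by have := size_minCpoly z; rewrite qE size_map_poly.
  by move: q1; lia.
- by apply: pz; rewrite pE rmorphM rootM rw.
by exists m.+1; rewrite exprSr pE rE qPhi.
Qed.

Lemma det_sub1_char_poly (F : comNzRingType) n (A : 'M[F]_n) :
  \det (1%:M - A) = (char_poly A).[1].
Proof.
rewrite /char_poly -[RHS]/(horner_eval 1 _) -det_map_mx; congr (\det _).
apply/matrixP => i j; rewrite !mxE -[RHS]/(('X *+ (i == j) - (A i j)%:P).[1]).
rewrite hornerD hornerN hornerC.
by rewrite hornerMn hornerX.
Qed.

(** If an eigenvalue had order [k < d], its eigenvector would be fixed by [A ^+ k], although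
    [A ^+ k - 1] is invertible. The degree and the value at 1 of the characteristic polynomial then
    give the two conclusions. *)
Lemma fixed_point_free_det n (A : 'M[rat]_n.+1) d : (0 < d)%N -> A ^+ d = 1 ->
  (forall k, (0 < k < d)%N -> \det (A ^+ k - 1%:M) != 0) ->
  exists2 m, n.+1 = (m * totient d)%N &
    \det (1%:M - A) = (('Phi_d).[1])%:~R ^+ m.
Proof.
move=> d0 Ad Ak; pose A' : 'M[algC]_n.+1 := map_mx ratr A.
have [|m pE] := primitive_roots_Cyclotomic (d := d) (char_poly_monic A).
  move=> z; rewrite map_char_poly -eigenvalue_root_char => /eigenvalueP[v vA v0].
  have vX k : v *m A' ^+ k = z ^+ k *: v.
    elim: k => [|k IHk]; first by rewrite !expr0 mulmx1 scale1r.
    by rewrite exprS [A' * _]/(A' *m _) mulmxA vA -scalemxAl IHk scalerA -exprS.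
  have zd : z ^+ d = 1.
    apply/eqP; rewrite -subr_eq0; move: (vX d).
    rewrite /A' -rmorphXn Ad rmorph1 mulmx1 => /eqP.
    rewrite -subr_eq0 -{1}[v]scale1r -scalerBl scaler_eq0 (negbTE v0) orbF.
    by rewrite -opprB oppr_eq0.
  have [k kd zk] := prim_order_exists d0 zd.
  have k0 := prim_order_gt0 kd; have := dvdn_leq d0 zk.
  rewrite leq_eqVlt => /orP[/eqP <- //|kltd].
  have := Ak k; rewrite k0 kltd => /(_ isT) /negP[].
  have : v *m (A' ^+ k - 1%:M) = 0.
    by rewrite mulmxBr vX (prim_expr_order kd) scale1r mulmx1 subrr.
  move=> vk; apply: contraNT v0 => dk.
  have uk : A' ^+ k - 1%:M \in unitmx.
    rewrite /A' -rmorphXn -(map_mx1 (ratr : rat -> algC)) -map_mxB.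
    by rewrite map_unitmx unitmxE unitfE.
  by rewrite -[v](mulmxK uk) vk mul0mx.
exists m.
  have := size_char_poly A; rewrite pE => /(congr1 predn) /= <-.
  rewrite size_exp size_map_poly_id0 ?size_Cyclotomic 1?mulnC //.
  by rewrite (monicP (Cyclotomic_monic d)) rmorph1 oner_eq0.
rewrite det_sub1_char_poly pE horner_exp -[1 in LHS](rmorph1 (intr : int -> rat)).
by rewrite horner_map.
Qed.

End CyclotomicPolynomials.

(** * Topology of the complex torus *)

Section ComplexTopology.
Variable R : realType.
Implicit Types (a b : R) (z w : CC R).

Definition of_re_im a b : CC R := Complex a b.
Definition re_part z : R := complex.Re z.
Definition im_part z : R := complex.Im z.

Lemma of_re_imK z : of_re_im (re_part z) (im_part z) = z.
Proof. by case: z. Qed.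

Lemma re_partB z w : re_part (z - w) = re_part z - re_part w.
Proof. by case: z; case: w. Qed.

Lemma im_partB z w : im_part (z - w) = im_part z - im_part w.
Proof. by case: z; case: w. Qed.

Lemma re_im_part_int (m : int) :
  re_part (m%:~R : CC R) = m%:~R /\ im_part (m%:~R : CC R) = 0.
Proof.
have -> : (m%:~R : CC R) = (real_complex R (m%:~R)) by rewrite rmorph_int.
by [].
Qed.

Lemma re_part_le z : (real_complex R `|re_part z| : CC R) <= `|z|.
Proof. exact: normc_ge_Re. Qed.

Lemma im_part_le z : (real_complex R `|im_part z| : CC R) <= `|z|.
Proof.
have := normc_ge_Re (z * (Complex 0 1)); rewrite ReiNIm normrN => /le_trans; apply.
have -> : `|z * (Complex 0 1)| = `|z| * `|(Complex 0 1 : R[i])| by rewrite normrM.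
by rewrite normc_def /= expr0n expr1n add0r sqrtr1 mulr1.
Qed.

Lemma norm_real_complex a : `|real_complex R a : CC R| = real_complex R `|a|.
Proof. by rewrite normc_def /= expr0n addr0 sqrtr_sqr. Qed.

Lemma cvg_re_part (T : Type) (F : set_system T) (FF : Filter F) (f : T -> CC R) z :
  f @ F --> z -> re_part (f x) @[x --> F] --> re_part z.
Proof.
move=> fz; apply/cvgrPdist_lt => e e0.
have e0C : 0 < (real_complex R e : CC R) by rewrite (ltcR 0).
move: fz => /cvgrPdist_lt/(_ _ e0C) fe.
near=> x; have fx := near fe x; rewrite -re_partB -ltcR.
apply: le_lt_trans (re_part_le _) _; exact: fx.
Unshelve. all: by end_near. Qed.

Lemma cvg_im_part (T : Type) (F : set_system T) (FF : Filter F) (f : T -> CC R) z :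
  f @ F --> z -> im_part (f x) @[x --> F] --> im_part z.
Proof.
move=> fz; apply/cvgrPdist_lt => e e0.
have e0C : 0 < (real_complex R e : CC R) by rewrite (ltcR 0).
move: fz => /cvgrPdist_lt/(_ _ e0C) fe.
near=> x; have fx := near fe x; rewrite -im_partB -ltcR.
apply: le_lt_trans (im_part_le _) _; exact: fx.
Unshelve. all: by end_near. Qed.

Lemma cvg_real_complex (T : Type) (F : set_system T) (FF : Filter F) (f : T -> R) a :
  f @ F --> a -> (real_complex R (f x) : CC R) @[x --> F] --> (real_complex R a : CC R).
Proof.
move=> fa; apply/cvgrPdist_lt => e e0.
(* Norms on [CC R] take values in [CC R], so the radius is a positive complex number, hence real. *)
have eE : e = real_complex R (complex.Re e) by rewrite RRe_real ?gtr0_real.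
have e0R : 0 < complex.Re e by rewrite -ltcR -eE.
move: fa => /cvgrPdist_lt/(_ _ e0R) fe.
near=> x; have fx := near fe x; rewrite -(rmorphB (real_complex R)) norm_real_complex.
rewrite eE ltcR; exact: fx.
Unshelve. all: by end_near. Qed.

Lemma cvg_of_re_im (T : Type) (F : set_system T) (FF : Filter F) (f g : T -> R) a b :
  f @ F --> a -> g @ F --> b ->
  of_re_im (f x) (g x) @[x --> F] --> of_re_im a b.
Proof.
have E a' b' : of_re_im a' b' =
    (real_complex R a' : CC R) + (Complex 0 1 : CC R) * (real_complex R b' : CC R).
  exact: complexE.
move=> fa gb; rewrite E; under eq_cvg do rewrite E.
by apply: cvgD; [exact: cvg_real_complex|apply: cvgMl_tmp; exact: cvg_real_complex].
Qed.

End ComplexTopology.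

Lemma cvg_mulmx (K : numFieldType) m n (A : 'M[K]_(m, n)) (T : Type)
    (F : set_system T) (FF : Filter F) (f : T -> 'cV[K]_n) l :
  f @ F --> l -> A *m f x @[x --> F] --> A *m l.
Proof.
move=> fl; apply: cvg_mx => i j; rewrite mxE; under eq_cvg do rewrite mxE.
apply: cvg_big => [|k _]; first exact: add_continuous.
apply: cvgMl_tmp.
apply: (cvg_comp f (fun x : 'cV[K]_n => x k j) fl); exact: coord_continuous.
Qed.

Section ComplexTorus.
Local Open Scope quotient_scope.
Variables (R : realType) (n : nat) (L : zmodClosed 'cV[rat]_n).
Variable B : 'M[rat]_n.
Hypotheses (uB : B \in unitmx)
  (LB : forall v, v \in L <-> exists z : 'cV[int]_n, v = B *m map_mx intr z).
Local Notation V := ('rV[R]_n * 'rV[R]_n)%type.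
Local Notation pi := (\pi_(torus R L) : 'cV[CC R]_n -> torus R L).
Local Notation repr := (generic_quotient.repr : torus R L -> 'cV[CC R]_n).

Definition complex_basis : 'M[CC R]_n := map_mx ratr B.
Local Notation BC := complex_basis.

Lemma complex_basis_unit : BC \in unitmx.
Proof. by rewrite map_unitmx. Qed.

Definition lattice_coord (x : 'cV[CC R]_n) : 'cV[CC R]_n := invmx BC *m x.

Lemma complex_latticeP x : x \in complex_lattice L <-> integral (lattice_coord x).
Proof.
have BZ (z : 'cV[int]_n) :
    map_mx ratr (B *m map_mx intr z) = BC *m map_mx intr z :> 'cV[CC R]_n.
  rewrite map_mxM; congr (_ *m _); apply/matrixP => i j; rewrite !mxE.
  exact: rmorph_int.
split=> [/asboolP[v /LB[z ->] ->]|[z xz]].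
  by exists z; rewrite BZ /lattice_coord mulKmx ?complex_basis_unit.
apply/asboolP; exists (B *m map_mx intr z); first by apply/LB; exists z.
by rewrite BZ -xz /lattice_coord mulKVmx ?complex_basis_unit.
Qed.

Definition re_coord j x : R := re_part (lattice_coord x j 0).
Definition im_coord j x : R := im_part (lattice_coord x j 0).

Lemma integral_re_imP (x : 'cV[CC R]_n) : integral x <->
  forall j, (exists m : int, re_part (x j 0) = m%:~R) /\ im_part (x j 0) = 0.
Proof.
split=> [[z ->] j|].
  rewrite mxE; have [-> ->] := re_im_part_int R (z j 0).
  by split=> //; exists (z j 0).
move=> xP; have /boolp.choice[m mP] j := (xP j).1.
exists (\col_j m j); apply/colP => j; rewrite !mxE.
rewrite -[LHS]of_re_imK -[RHS]of_re_imK mP (xP j).2.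
by have [-> ->] := re_im_part_int R (m j).
Qed.

Lemma integral_re_inj (x y : 'cV[CC R]_n) : integral x -> integral y ->
  (forall j, re_part (x j 0) = re_part (y j 0)) -> x = y.
Proof.
move=> /integral_re_imP xZ /integral_re_imP yZ xy.
apply/colP => j; rewrite -(of_re_imK (x j 0)) -(of_re_imK (y j 0)) xy.
by rewrite (xZ j).2 (yZ j).2.
Qed.

Lemma lattice_coord_inj : injective lattice_coord.
Proof. exact: can_inj (mulKVmx complex_basis_unit). Qed.

Lemma lattice_coordB x y : lattice_coord (x - y) = lattice_coord x - lattice_coord y.
Proof. exact: mulmxBr. Qed.

Lemma torus_pi_eqP x y : pi x = pi y <->
  forall j, (exists m : int, re_coord j x = re_coord j y + m%:~R) /\
            im_coord j x = im_coord j y.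
Proof.
have -> : pi x = pi y <-> integral (lattice_coord x - lattice_coord y).
  rewrite -lattice_coordB -complex_latticeP; exact: rwP (torus_eqP _ _ _).
have sE j : (lattice_coord x - lattice_coord y) j 0 =
    lattice_coord x j 0 - lattice_coord y j 0.
  by rewrite !mxE.
rewrite integral_re_imP; split=> xy j; have [[m mE] iE] := xy j.
  move: mE iE; rewrite sE re_partB im_partB => mE /subr0_eq iE.
  by split=> //; exists m; rewrite -mE addrC subrK.
rewrite sE re_partB im_partB -/(re_coord j x) -/(im_coord j x) mE iE subrr.
by split=> //; exists m; rewrite addrC addKr.
Qed.

Lemma continuous_lattice_coord : continuous lattice_coord.
Proof. by move=> x; apply: (@cvg_mulmx _ _ _ _ _ (nbhs x)); exact: cvg_id. Qed.

Lemma cvg_coord (T : Type) (F : set_system T) (FF : Filter F)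
    (f : T -> 'cV[CC R]_n) (l : 'cV[CC R]_n) : f @ F --> l -> forall j,
  f x j 0 @[x --> F] --> l j 0.
Proof.
move=> fl j; apply: (cvg_comp f (fun x : 'cV[CC R]_n => x j 0) fl).
exact: coord_continuous.
Qed.

Lemma continuous_re_coord j : continuous (re_coord j).
Proof.
move=> x; apply: (@cvg_re_part _ _ (nbhs x)); apply: (@cvg_coord _ (nbhs x)).
exact: continuous_lattice_coord.
Qed.

Lemma continuous_im_coord j : continuous (im_coord j).
Proof.
move=> x; apply: (@cvg_im_part _ _ (nbhs x)); apply: (@cvg_coord _ (nbhs x)).
exact: continuous_lattice_coord.
Qed.

Definition torus_param (v : V) : 'cV[CC R]_n :=
  BC *m \col_j of_re_im (v.1 0 j) (v.2 0 j).

Lemma lattice_coord_param v j :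
  lattice_coord (torus_param v) j 0 = of_re_im (v.1 0 j) (v.2 0 j).
Proof. by rewrite /lattice_coord mulKmx ?complex_basis_unit // mxE. Qed.

Lemma re_coord_param v j : re_coord j (torus_param v) = v.1 0 j.
Proof. by rewrite /re_coord lattice_coord_param. Qed.

Lemma im_coord_param v j : im_coord j (torus_param v) = v.2 0 j.
Proof. by rewrite /im_coord lattice_coord_param. Qed.

Lemma torus_param_coord x :
  torus_param (\row_j re_coord j x, \row_j im_coord j x) = x.
Proof.
rewrite -[RHS](mulKVmx complex_basis_unit); congr (_ *m _).
by apply/colP => j; rewrite !mxE of_re_imK mxE.
Qed.

Lemma continuous_torus_param : continuous torus_param.
Proof.
move=> v; apply: (@cvg_mulmx _ _ _ _ _ (nbhs v)).
apply: (@cvg_mx _ _ (nbhs v)) => i j; rewrite mxE; under eq_cvg do rewrite mxE.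
have rc k : continuous (fun M : 'rV[R]_n => M 0 k).
  by move=> M; exact: coord_continuous.
apply: (@cvg_of_re_im _ _ (nbhs v)).
  exact: (cvg_comp (fun v : V => v.1) (fun M => M 0 i) cvg_fst (rc i _)).
exact: (cvg_comp (fun v : V => v.2) (fun M => M 0 i) cvg_snd (rc i _)).
Qed.

Definition torus_cover (v : V) : torus R L := pi (torus_param v).

Lemma continuous_torus_cover : continuous torus_cover.
Proof.
move=> v; apply: continuous_comp; first exact: continuous_torus_param.
exact: pi_continuous.
Qed.

Lemma torus_cover_surj x : exists v, torus_cover v = x.
Proof.
exists (\row_j re_coord j (repr x), \row_j im_coord j (repr x)).
by rewrite /torus_cover torus_param_coord reprK.
Qed.

(** Read on a representative; [torus_cosE] shows that the choice is immaterial, and continuity then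
    follows from the quotient topology. *)
Definition torus_cos j (x : torus R L) : R := cost (re_coord j (repr x)).
Definition torus_sin j (x : torus R L) : R := sint (re_coord j (repr x)).
Definition torus_im j (x : torus R L) : R := im_coord j (repr x).

Let pi_repr x : pi (repr (pi x)) = pi x. Proof. exact: reprK. Qed.

Lemma torus_cosE j x : torus_cos j (pi x) = cost (re_coord j x).
Proof.
have /torus_pi_eqP/(_ j)[[m mE] _] := pi_repr x.
by rewrite /torus_cos mE (cost_sintDz _ m).1.
Qed.

Lemma torus_sinE j x : torus_sin j (pi x) = sint (re_coord j x).
Proof.
have /torus_pi_eqP/(_ j)[[m mE] _] := pi_repr x.
by rewrite /torus_sin mE (cost_sintDz _ m).2.
Qed.

Lemma torus_imE j x : torus_im j (pi x) = im_coord j x.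
Proof. by have /torus_pi_eqP/(_ j)[_] := pi_repr x. Qed.

Lemma continuous_torus_cos j : continuous (torus_cos j).
Proof.
apply/quotient_continuous => x; rewrite /comp.
have -> : (fun x => torus_cos j (pi x)) = @cost R \o re_coord j.
  by apply/funext => y; rewrite torus_cosE.
apply: continuous_comp; [exact: continuous_re_coord | exact: continuous_cost].
Qed.

Lemma continuous_torus_sin j : continuous (torus_sin j).
Proof.
apply/quotient_continuous => x; rewrite /comp.
have -> : (fun x => torus_sin j (pi x)) = @sint R \o re_coord j.
  by apply/funext => y; rewrite torus_sinE.
apply: continuous_comp; [exact: continuous_re_coord | exact: continuous_sint].
Qed.

Lemma continuous_torus_im j : continuous (torus_im j).
Proof.
apply/quotient_continuous => x; rewrite /comp.
have -> : (fun x => torus_im j (pi x)) = im_coord j.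
  by apply/funext => y; rewrite torus_imE.
exact: continuous_im_coord.
Qed.

Lemma torus_cover_periodic (v w : V) :
  (forall j, exists m : int, v.1 0 j = w.1 0 j + m%:~R) -> v.2 = w.2 ->
  torus_cover v = torus_cover w.
Proof.
move=> v1 v2; apply/torus_pi_eqP => j; rewrite !re_coord_param !im_coord_param.
by rewrite v2.
Qed.

(** Stated for a subspace containing every point, because the fixed locus of the identity is a type
    distinct from [torus R L]. *)
Lemma full_torus_betti (A : set (torus R L)) (AT : forall x, A x) k :
  is_betti R A k 'C(n, k).
Proof.
pose p (v : V) : A := in_set_type (AT (torus_cover v)).
have pc : continuous p.
  by apply: continuous_comp_initial; exact: continuous_torus_cover.
have val_cont (f : torus R L -> R) :
    continuous f -> continuous (fun x : A => f (set_val x)).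
  by move=> fc x; apply: continuous_comp; [exact: initial_continuous | exact: fc].
apply: (@torus_betti R n A (mkcts pc)
  (fun j x => torus_cos j (set_val x)) (fun j x => torus_sin j (set_val x))
  (fun j x => torus_im j (set_val x))).
- by move=> j; apply: val_cont; exact: continuous_torus_cos.
- by move=> j; apply: val_cont; exact: continuous_torus_sin.
- by move=> j; apply: val_cont; exact: continuous_torus_im.
- by move=> j v; rewrite torus_cosE re_coord_param.
- by move=> j v; rewrite torus_sinE re_coord_param.
- by move=> j v; rewrite torus_imE im_coord_param.
- move=> x; have [v vx] := torus_cover_surj (set_val x).
  by exists v; apply/val_inj.
- by move=> v w vw1 vw2; apply/val_inj; exact: torus_cover_periodic.
Qed.

Lemma torus_simplex_lift k (s : singular_simplex R (torus R L) k) :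
  exists s' : std_simplex R k -> 'cV[CC R]_n,
    continuous s' /\ forall x, pi (s' x) = s x.
Proof.
have [|||s' s'E] := @torus_lift R n (torus R L) (mkcts continuous_torus_cover)
  torus_cos torus_sin torus_im continuous_torus_cos continuous_torus_sin
  continuous_torus_im _ _ _ torus_cover_surj torus_cover_periodic k s.
- by move=> j v; rewrite torus_cosE re_coord_param.
- by move=> j v; rewrite torus_sinE re_coord_param.
- by move=> j v; rewrite torus_imE im_coord_param.
exists (torus_param \o s'); split=> [x|x]; last by rewrite -s'E.
by apply: continuous_comp; [exact: cts_fun | exact: continuous_torus_param].
Qed.

End ComplexTorus.

(** * Fixed points *)

Section FixedPoints.
Local Open Scope quotient_scope.
Variables (R : realType) (gT : finGroupType) (G : {group gT}) (n : nat).
Variables (rG : mx_representation rat G n) (L : zmodClosed 'cV[rat]_n).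
Hypothesis GL : invariant_lattice rG L.
Variable B : 'M[rat]_n.
Hypotheses (uB : B \in unitmx)
  (LB : forall v, v \in L <-> exists z : 'cV[int]_n, v = B *m map_mx intr z).
Local Notation pi := (\pi_(torus R L) : 'cV[CC R]_n -> torus R L).
Local Notation BC := (complex_basis R B).
Local Notation coord := (@lattice_coord R n B).
Local Notation fixed g := (fixed_points (torus_act R rG L g)).

Lemma torus_act1 x : fixed 1%g x.
Proof.
rewrite /fixed_points /= /torus_act /complex_act repr_mx1 map_mx1 mul1mx.
exact: reprK.
Qed.

Section NontrivialElement.
Variable g : gT.
Hypotheses (gG : g \in G) (det_g : \det (rG g - 1%:M) != 0).

Lemma lattice_matrix : exists M : 'M[int]_n,
  (rG g - 1%:M) *m B = B *m map_mx intr M.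
Proof.
have /boolp.choice[z zP] j : exists z : 'cV[int]_n,
    (rG g - 1%:M) *m col j B = B *m map_mx intr z.
  have colL : col j B \in L.
    apply/LB; exists (delta_mx j 0); rewrite map_delta_mx colE.
    by congr (_ *m _); apply/matrixP => a b; rewrite !mxE.
  by apply/LB; rewrite mulmxBl mul1mx rpredB // GL.
exists (\matrix_(i, j) z j i 0); apply/matrixP => i j.
have : col j ((rG g - 1%:M) *m B) = B *m map_mx intr (z j).
  by rewrite colE -mulmxA -colE.
move=> /colP/(_ i); rewrite mxE => ->; rewrite !mxE.
by apply: eq_bigr => a _; rewrite !mxE.
Qed.

Variable M : 'M[int]_n.
Hypothesis MB : (rG g - 1%:M) *m B = B *m map_mx intr M.
Local Notation MC := (map_mx intr M : 'M[CC R]_n).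

Lemma det_lattice_matrix : (\det M)%:~R = \det (rG g - 1%:M).
Proof.
have := congr1 determinant MB; rewrite !det_mulmx mulrC => /mulfI ->.
  by rewrite det_map_mx.
by move: uB; rewrite unitmxE unitfE.
Qed.

Lemma lattice_matrix_unit : MC \in unitmx.
Proof.
by rewrite unitmxE det_map_mx unitfE intr_eq0 -(intr_eq0 rat) det_lattice_matrix.
Qed.

Lemma coord_act x : coord (complex_act rG g x - x) = MC *m coord x.
Proof.
have MBC : map_mx ratr (rG g - 1%:M) *m BC = BC *m MC.
  rewrite /complex_basis -map_mxM MB map_mxM; congr (_ *m _).
  by apply/matrixP => i j; rewrite !mxE; exact: rmorph_int.
have -> : complex_act rG g x - x = map_mx ratr (rG g - 1%:M) *m x.
  by rewrite map_mxB map_mx1 mulmxBl mul1mx.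
rewrite /lattice_coord -{1}[x](mulKVmx (complex_basis_unit R uB)).
rewrite [_ *m (BC *m _)]mulmxA MBC.
by rewrite -mulmxA mulKmx // complex_basis_unit.
Qed.

Lemma fixed_piP x : fixed g (pi x) <-> integral (MC *m coord x).
Proof.
rewrite -coord_act -(complex_latticeP uB LB) /fixed_points /= torus_act_pi //.
exact: rwP (torus_eqP _ _ _).
Qed.

Lemma fixed_simplex_constant k (s : singular_simplex R (fixed g) k) x y : s x = s y.
Proof.
have tc : continuous (set_val \o s).
  by move=> z; apply: continuous_comp; [exact: cts_fun | exact: initial_continuous].
have [s' [s'c s'E]] := torus_simplex_lift uB LB (mkcts tc).
have ZM z : integral (MC *m coord (s' z)).
  by apply/fixed_piP; rewrite s'E; exact: set_valP.
(* Integral vectors have zero imaginary part, so real parts suffice. *)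
have cst j : re_part ((MC *m coord (s' x)) j 0) = re_part ((MC *m coord (s' y)) j 0).
  apply: (integer_valued_constant
    (f := fun z => re_part ((MC *m coord (s' z)) j 0))) => z; last first.
    by have /integral_re_imP/(_ j)[] := ZM z.
  apply: (@cvg_re_part _ _ (nbhs z)); apply: (@cvg_coord _ _ _ (nbhs z)).
  apply: (@cvg_mulmx _ _ _ _ _ (nbhs z)); apply: (@cvg_mulmx _ _ _ _ _ (nbhs z)).
  exact: s'c.
have Mxy := integral_re_inj (ZM x) (ZM y) cst.
have xy : s' x = s' y.
  apply: (lattice_coord_inj uB).
  exact: (can_inj (mulKmx lattice_matrix_unit) Mxy).
by apply/val_inj; rewrite -[LHS]s'E -[RHS]s'E xy.
Qed.

(** In lattice coordinates the fixed locus is $M^{-1}\mathbb Z^n/\mathbb Z^n$, which [lattice_index]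
    enumerates. *)
Lemma fixed_points_bijection :
  exists f : 'I_`|\det M| -> fixed g, bijective f.
Proof.
have detM : \det M != 0 by rewrite -(intr_eq0 rat) det_lattice_matrix.
have [y [y1 y2 y3]] := lattice_index (CC R) detM.
have coordK v : coord (BC *m v) = v.
  by rewrite /lattice_coord mulKmx // complex_basis_unit.
have fy i : fixed g (pi (BC *m y i)) by apply/fixed_piP; rewrite coordK.
pose f i : fixed g := in_set_type (fy i).
have fI : injective f.
  move=> i j /(congr1 set_val) /= /torus_eqP /(complex_latticeP uB LB).
  by rewrite -mulmxBr coordK; exact: y2.
have /boolp.choice[h hP] (z : fixed g) : exists i, f i = z.
  pose x := generic_quotient.repr (set_val z).
  have zE : pi x = set_val z by exact: reprK.
  have : fixed g (pi x) by rewrite zE; exact: set_valP.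
  move=> /fixed_piP/y3[i xi]; exists i; apply/val_inj; rewrite -[RHS]zE.
  apply/esym/torus_eqP/(complex_latticeP uB LB).
  by rewrite /lattice_coord mulmxBr -/(coord x) -/(coord (BC *m y i)) coordK.
by exists f, h => // i; apply: fI.
Qed.

End NontrivialElement.

Lemma fixed_points_betti g : g \in G -> \det (rG g - 1%:M) != 0 ->
  exists2 N, N%:R = `|\det (rG g - 1%:M)| &
    forall k, is_betti R (fixed g) k (if k is 0%N then N else 0%N).
Proof.
move=> gG det_g; have [M MB] := lattice_matrix gG.
have [f f_bij] := fixed_points_bijection gG det_g MB.
exists `|\det M|%N; first by rewrite -(det_lattice_matrix MB) -intr_norm natr_absz.
have cst := fixed_simplex_constant gG det_g MB.
case=> [|k]; [exact: constant_betti0 cst _ _ f_bij | exact: constant_bettiS cst _].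
Qed.

End FixedPoints.

(** * The orbifold Euler characteristic *)

(** Each cyclic subgroup of order [d] is generated by exactly [totient d] elements, all of order
    [d]. *)
Lemma sum_order_cyclic (K : pzSemiRingType) (gT : finGroupType) (G : {group gT})
    (a : nat -> K) :
  \sum_(g in G) a #[g]%g =
  \sum_(d <- divisors #|G|) (totient d)%:R * #|cyclic_subgroups G d|%:R * a d.
Proof.
pose cyc (H : {group gT}) := (H \subset G) && cyclic H.
rewrite (partition_big (fun g => <[g]>%G) cyc) /=; last first.
  by move=> g gG; rewrite /cyc /= cycle_subG gG cycle_cyclic.
have gens H : cyc H ->
    \sum_(g in G | <[g]>%G == H) a #[g]%g = (totient #|H|)%:R * a #|H|.
  move=> /andP[HG /cyclicP[x Hx]].
  rewrite (eq_bigr (fun=> a #|H|)) => [|g /andP[_ /eqP <-]//].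
  rewrite sumr_const -[LHS]mulr_natl; congr (_%:R * _).
  have -> : #|H| = #[x]%g by rewrite Hx.
  rewrite totient_gen; apply: eq_card => g.
  rewrite unfold_in inE /generator -Hx.
  apply/andP/eqP => [[_ /eqP <-] //|Hg]; split; first by rewrite -cycle_subG -Hg.
  by apply/eqP/val_inj; rewrite /= Hg.
rewrite (eq_bigr _ gens).
transitivity (\sum_(d <- divisors #|G|)
    \sum_(H : {group gT} | cyc H && (#|H| == d)) (totient #|H|)%:R * a #|H|).
  rewrite (exchange_big_dep cyc) /=; last by move=> d H _ /andP[].
  apply: eq_bigr => H cH; rewrite -big_filter.
  rewrite (_ : [seq _ <- _ | _] = [:: #|H|]) ?big_seq1 //.
  apply: (@perm_small_eq _ _ [:: #|H|]) => //.
  apply: uniq_perm; rewrite ?filter_uniq ?divisors_uniq // => d.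
  rewrite mem_filter inE cH /= eq_sym; case: eqP => //= ->.
  by rewrite -dvdn_divisors ?cardG_gt0 // cardSg //; case/andP: cH.
apply: eq_bigr => d _; rewrite (eq_bigr (fun=> (totient d)%:R * a d)); last first.
  by move=> H /andP[_ /eqP ->].
rewrite sumr_const -[RHS]mulrA [_%:R * a d in RHS]mulr_natl mulrnAr.
congr (_ *+ _); apply: eq_card => H.
by rewrite unfold_in inE /cyc andbA.
Qed.

Lemma sum_sign_binomial n : (0 < n)%N ->
  \sum_(k < n.+1) (-1) ^+ k * ('C(n, k))%:Z = 0.
Proof.
move=> n0; have := exprBn (1 : int) 1 n; rewrite subrr expr0n gtn_eqF // => /esym E.
etransitivity; last exact: E.
apply: eq_bigr => k _; rewrite !expr1n !mulr1 -mulr_natr; congr (_ * _).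
by rewrite natz.
Qed.

Lemma det_fpf_Cyclotomic (gT : finGroupType) (G : {group gT}) (n : nat)
    (rG : mx_representation rat G n) g :
  rational_fpf rG -> g \in G -> g != 1%g ->
  exists2 m, n = (m * totient #[g]%g)%N &
    `|\det (rG g - 1%:M)| = (('Phi_#[g]%g).[1])%:~R ^+ m.
Proof.
case: n rG => [|n] rG [//= _ fpf] gG g1.
have [||k /andP[k0 kd]|m nE dE] := @fixed_point_free_det n (rG g) #[g]%g.
- exact: order_gt0.
- by rewrite -repr_mxX // expg_order repr_mx1.
- rewrite -repr_mxX //; apply: fpf; first by rewrite groupX.
  by rewrite -order_dvdn gtnNdvd.
exists m => //.
have -> : rG g - 1%:M = - (1%:M - rG g) by rewrite opprB.
rewrite -scaleN1r detZ normrM normrX normrN1 expr1n mul1r dE.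
rewrite ger0_norm // exprn_ge0 // ler0z ltW // Cyclotomic1_gt0 //.
by rewrite order_gt1.
Qed.

Lemma fixed_points_euler_char (R : realType) (gT : finGroupType) (G : {group gT})
    (n : nat) (rG : mx_representation rat G n) (L : zmodClosed 'cV[rat]_n) g :
  rational_fpf rG -> full_rank_lattice L -> invariant_lattice rG L -> g \in G ->
  finite_homology R (fixed_points (torus_act R rG L g)) /\
  (euler_char R (fixed_points (torus_act R rG L g)))%:~R =
    (('Phi_#[g]%g).[1])%:~R `^ (n%:R / (totient #[g]%g)%:R) :> R.
Proof.
move=> fpf [B uB LB] GL gG; have n0 := fpf.1.
have [->|g1] := eqVneq g 1%g.
  have b := full_torus_betti uB LB (@torus_act1 R gT G n rG L).
  have b0 k : (n.+1 <= k)%N -> 'C(n, k) = 0%N by move=> nk; rewrite bin_small.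
  split; first exact: betti_finite_homology b _ b0.
  rewrite (euler_charE b b0) sum_sign_binomial // order1.
  have -> : 'Phi_1 = 'X - 1.
    by have := prod_Cyclotomic (ltn0Sn 0); rewrite big_seq1 expr1.
  (* Positivity of [n] matters: the real power of 0 with exponent 0 is 1. *)
  rewrite hornerD hornerN hornerX hornerC subrr powR0 //.
  by rewrite divr1 pnatr_eq0 -lt0n.
have [N NE b] := fixed_points_betti R GL uB LB gG (fpf.2 g gG g1).
have b0 k : (1 <= k)%N -> (if k is 0 then N else 0)%N = 0%N by case: k.
split; first exact: betti_finite_homology b _ b0.
have [m nE dE] := det_fpf_Cyclotomic fpf gG g1.
have phi0 : (0 < totient #[g]%g)%N by rewrite totient_gt0 order_gt0.
rewrite (euler_charE b b0) big_ord1 expr0 mul1r.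
(* [totient #[g]] divides [n], so the real power is an ordinary one. *)
have -> : n%:R / (totient #[g]%g)%:R = m%:R :> R.
  by rewrite {1}nE natrM mulfK // pnatr_eq0 -lt0n.
rewrite powR_mulrn; last first.
  by rewrite ler0z ltW // Cyclotomic1_gt0 // order_gt1.
have : N%:Z = ('Phi_#[g]%g).[1] ^+ m.
  by apply: (@intr_inj rat); rewrite rmorphXn /= -dE -NE.
by move=> ->; rewrite rmorphXn.
Qed.

Unset Implicit Arguments.

(** The finiteness conjunct ensures that [betti] and the sum over all degrees are not default
    values. The power has a real exponent because [totient d] need not divide [n] when no cyclic
    subgroup has order [d]; such terms have coefficient 0. *)
Theorem corollary3p7 (R : realType) (gT : finGroupType) (G : {group gT})
    (n : nat) (rG : mx_representation rat G n) (L : zmodClosed 'cV[rat]_n) :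
  rational_fpf rG -> full_rank_lattice L -> invariant_lattice rG L ->
  (forall g, g \in G ->
     finite_homology R (fixed_points (torus_act R rG L g))) /\
  orb_euler_char R G (torus_act R rG L) =
    #|G|%:R^-1 *
    \sum_(d <- divisors #|G|)
       (totient d)%:R * #|cyclic_subgroups G d|%:R *
       (('Phi_d).[1])%:~R `^ (n%:R / (totient d)%:R).
Proof.
move=> fpf latL GL; split=> [g gG|].
  by have [] := fixed_points_euler_char R fpf latL GL gG.
rewrite /orb_euler_char -sum_order_cyclic; congr (_ * _).
apply: eq_bigr => g gG.
by have [_ ->] := fixed_points_euler_char R fpf latL GL gG.
Qed.
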